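(* Let $m\geq 1$. There exist constants $A_m$, $B_m$, $C_m$ (depending only on $m$) such that the following holds. Let $(\mathbb{H},\langle\cdot,\cdot\rangle)$ be a separable Hilbert space with norm $\|\cdot\|_{\mathbb{H}}$, let $(\xi_i)_{i\geq 1}$ be an i.i.d. sequence taking values in a measurable space $(S,\mathcal{S})$, and let $h_{\mathbf{i}}\colon S^m\to\mathbb{H}$, $\mathbf{i}\in\operatorname{Inc}^m$, be measurable functions such that for each $\mathbf{i}\in\operatorname{Inc}^m$ and each $j_0\in\{1,\dots,m\}$, $$\mathbb{E}\big[h_{\mathbf{i}}(\xi_1,\dots,\xi_m)\mid \xi_j, j\in\{1,\dots,m\}\setminus\{j_0\}\big]=0\quad\text{a.s.}$$ Then for all $x,y>0$ and every integer $N\geq m$, $$\mathbb{P}\Big(\max_{m\leq n\leq N}\Big\|\sum_{\mathbf{i}\in\operatorname{Inc}^m_n}h_{\mathbf{i}}(\xi_{\mathbf{i}})\Big\|_{\mathbb{H}}>x\Big)\leq A_m\exp\Big(-\Big(\frac{x}{y}\Big)^{2/m}\Big)+B_m\int_1^\infty u(1+\log u)^{\frac{m(m+1)}{2}-1}\,\mathbb{P}\Big(\sqrt{\sum_{\mathbf{i}\in\operatorname{Inc}^m_N}\big\|h_{\mathbf{i}}(\xi^{\mathrm{dec}}_{\mathbf{i}})\big\|_{\mathbb{H}}^2}>C_m y u\Big)\,du.$$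
   Context: $\operatorname{Inc}^m=\{(i_1,\dots,i_m)\in\mathbb{N}^m:1\leq i_1<\dots<i_m\}$ and $\operatorname{Inc}^m_n=\{(i_1,\dots,i_m)\in\mathbb{N}^m:1\leq i_1<\dots<i_m\leq n\}$. For $\mathbf{i}=(i_1,\dots,i_m)$, $\xi_{\mathbf{i}}=(\xi_{i_1},\dots,\xi_{i_m})$ and $\xi^{\mathrm{dec}}_{\mathbf{i}}=(\xi^{(1)}_{i_1},\dots,\xi^{(m)}_{i_m})$, where $(\xi^{(\ell)}_i)_{i\geq1}$, $\ell\in\{1,\dots,m\}$, are mutually independent copies of the sequence $(\xi_i)_{i\geq 1}$. *)

(* Defs.v *)
From HB Require Import structures.
From mathcomp Require Import all_boot all_order all_algebra.
From mathcomp Require Import all_classical all_reals all_analysis.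
Set Implicit Arguments. Unset Strict Implicit. Unset Printing Implicit Defensive.
Import Order.TTheory GRing.Theory Num.Theory.
Import numFieldNormedType.Exports.
Local Open Scope classical_set_scope.
Local Open Scope ring_scope.

Definition is_inner_product (R : realType) (H : normedModType R)
  (inner : H -> H -> R) : Prop :=
  [/\ (forall x y, inner x y = inner y x),
      (forall (a : R) (x y z : H), inner (a *: x + y) z = a * inner x z + inner y z),
      (forall x, 0 <= inner x x) &
      (forall x, `|x| = Num.sqrt (inner x x))].

Definition separable_space (T : topologicalType) : Prop :=
  exists D : set T, countable D /\ closure D = setT.

Definition borel_sets (T : topologicalType) : set (set T) := <<s [set U | open U] >>.

Definition prod_sigma (d : measure_display) (S : measurableType d) (m : nat)
  : set (set ('I_m -> S)) :=
  <<s [set B | exists (j : 'I_m) (A : set S), measurable A /\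
               B = (fun f : 'I_m -> S => f j) @^-1` A] >>.

Definition sigma_gen (d : measure_display) (T : measurableType d)
  (dS : measure_display) (S : measurableType dS) (I : Type)
  (X : I -> T -> S) (J : set I) : set (set T) :=
  <<s [set G | exists j A, J j /\ measurable A /\ G = X j @^-1` A] >>.

Definition mutually_indep (d : measure_display) (T : measurableType d) (R : realType)
  (P : probability T R) (dS : measure_display) (S : measurableType dS)
  (I : eqType) (X : I -> T -> S) (D : pred I) : Prop :=
  forall (F : seq I) (A : I -> set S), uniq F -> all D F ->
    (forall i, i \in F -> measurable (A i)) ->
    P (\big[setI/setT]_(i <- F) (X i @^-1` A i)) =
    (\prod_(i <- F) P (X i @^-1` A i))%E.

Definition iid_seq (d : measure_display) (T : measurableType d) (R : realType)
  (P : probability T R) (dS : measure_display) (S : measurableType dS)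
  (xi : nat -> T -> S) : Prop :=
  [/\ (forall i, (0 < i)%N -> measurable_fun setT (xi i)),
      mutually_indep P xi (fun i => (0 < i)%N) &
      (forall i A, (0 < i)%N -> measurable A -> P (xi i @^-1` A) = P (xi 1%N @^-1` A))].

Definition incb (m : nat) (i : m.-tuple nat) : bool := sorted ltn (0%N :: val i).

Definition Inc_sum (V : zmodType) (m n : nat) (F : m.-tuple nat -> V) : V :=
  \sum_(t : m.-tuple 'I_n.+1 | incb (map_tuple val t)) F (map_tuple val t).

(* Main.v *)
Require Import Defs.
From HB Require Import structures.
From mathcomp Require Import all_boot all_order all_algebra.
From mathcomp Require Import all_classical all_reals all_analysis measurable_realfun.
From mathcomp Require Import ring lra.
Import Order.TTheory GRing.Theory Num.Theory.
Import numFieldNormedType.Exports.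
Local Open Scope classical_set_scope.
Local Open Scope ring_scope.
Set Implicit Arguments. Unset Strict Implicit. Unset Printing Implicit Defensive.

(** The bound holds with the logarithmic factor replaced by [1].  Let [U n] be the
    partial sums, [a = x / 2] and [excess a t = max (t - a) 0].

    Since the kernels are degenerate, [excess a |U n|] is a submartingale, so that
    [a * P (max |U n| > x) <= E (excess a |U N|)].  Symmetrising one variable at a
    time only costs replacing [h_i] by [2 ^ m * eps_(i_1) ... eps_(i_m) * h_i] with
    independent signs [eps].  Conditionally on the [xi], Rademacher
    hypercontractivity bounds the moment of order [2k] of the norm of this chaos by
    [((20 k) ^ m * q) ^ k], where [q] is the sum of the [|h_i (xi_i)| ^ 2].  With
    [k] of the order of [(x / y) ^ (2 / m)], the conditional expectation of the
    excess, divided by [a], is at most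
    [exp (- (x / y) ^ (2 / m)) + K * max (q / y ^ 2 - c) 0].

    Only the scalar [q] has to be decoupled.  It is [m ^ m] times the average, over
    uniform colourings [delta] of the indices, of the sum of the terms with
    [delta (i_j) = j] for all [j]; by convexity of [t |-> max (t - c) 0], and since
    the variables [xi ^ (delta k)_k] are again i.i.d., [q] may be replaced by
    [m ^ m] times its decoupled version.  The layer-cake formula turns the
    expectation of the positive part into the integral of the tail. *)

(** * Product sigma-algebras, i.i.d. families and resampling of one coordinate *)

(** For [I = 'I_m] the generated sigma-algebra is [prod_sigma] up to conversion, so the
    measurability hypothesis on the kernels applies to [seqsp 'I_m S] as it stands. *)
Definition cylinder (I : Type) (d : measure_display) (S : measurableType d) :
    set (set (I -> S)) :=
  [set B | exists (j : I) (A : set S), measurable A /\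
           B = (fun f : I -> S => f j) @^-1` A].

Arguments cylinder I {d} S.

Notation seqsp I S := (g_sigma_algebraType (cylinder I S)).

Definition upd (I : choiceType) (S : Type) (s : I -> S) (k : I) (z : S) : I -> S :=
  fun i => if i == k then z else s i.

(** Independence and the common law [mu] in a single product formula; with [F] empty it also forces
    total mass 1. *)
Definition iid_family (d : measure_display) (T : measurableType d) (R : realType)
    (P : {measure set T -> \bar R}) (dS : measure_display) (S : measurableType dS)
    (mu : {measure set S -> \bar R}) (I : choiceType) (X : I -> T -> S) : Prop :=
  forall (F : seq I) (A : I -> set S), uniq F -> (forall i, measurable (A i)) ->
    P (\big[setI/setT]_(i <- F) (X i @^-1` A i)) = (\prod_(i <- F) mu (A i))%E.

Section SequenceSpace.
Context {dS : measure_display} {S : measurableType dS}.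

Lemma measurable_coord (I : Type) (j : I) :
  measurable_fun setT ((fun s : seqsp I S => s j) : seqsp I S -> S).
Proof.
move=> _ A mA; rewrite setTI; apply: sub_sigma_algebra.
by exists j, A.
Qed.

Lemma measurable_to_seqsp (d : measure_display) (T : measurableType d) (I : Type)
    (X : T -> I -> S) :
  (forall i, measurable_fun setT (fun w => X w i)) ->
  measurable_fun setT (X : T -> seqsp I S).
Proof.
move=> mX; apply: (@measurability _ _ _ _ setT (X : T -> seqsp I S)
  (cylinder I S)) => //.
move=> _ [_ [j [A [mA ->]]] <-].
by have := mX j measurableT A mA.
Qed.

Context {R : realType}.

(** Finite intersections of cylinders form a pi-system generating the product sigma-algebra, and the
    product formula fixes both measures on them. *)
Lemma iid_family_law_unique (I : choiceType) (mu : probability S R)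
    (nu1 nu2 : {measure set (seqsp I S) -> \bar R}) :
  iid_family nu1 mu (fun i (s : seqsp I S) => s i) ->
  iid_family nu2 mu (fun i (s : seqsp I S) => s i) ->
  forall A, measurable A -> nu1 A = nu2 A.
Proof.
move=> h1 h2.
pose G : set (set (I -> S)) := [set B | exists (F : seq I) (A : I -> set S),
  [/\ uniq F, forall i, measurable (A i) &
      B = \big[setI/setT]_(i <- F) ((fun s : I -> S => s i) @^-1` A i)]].
have GT : G setT.
  by exists [::], (fun=> setT); split => //; rewrite big_nil.
have mG : (measurable : set (set (seqsp I S))) = <<s G >>.
  apply/seteqP; split.
    apply: smallest_sub; first exact: smallest_sigma_algebra.
    move=> _ [j [A [mA ->]]]; apply: sub_sigma_algebra.
    by exists [:: j], (fun=> A); split => //; rewrite big_seq1.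
  apply: smallest_sub; first exact: smallest_sigma_algebra.
  move=> _ [F [A [uF mA ->]]].
  apply: (@bigsetI_measurable _ (seqsp I S)) => i _.
  by rewrite -[X in measurable X]setTI; exact: measurable_coord.
have GI : setI_closed G.
  move=> _ _ [F1 [A1 [u1 m1 ->]]] [F2 [A2 [u2 m2 ->]]].
  (* Both families are merged over one duplicate-free list; an index missing from one of them
     contributes [setT] there. *)
  exists (undup (F1 ++ F2)), (fun i => (if i \in F1 then A1 i else setT) `&`
                                       (if i \in F2 then A2 i else setT)).
  split; first exact: undup_uniq.
    by move=> i; apply: measurableI; case: ifP.
  rewrite -!bigcap_seq; apply/seteqP; split => s.
    move=> [s1 s2] i /=; rewrite mem_undup mem_cat => iF; split.
      by case: ifPn => // i1; exact: s1.
    by case: ifPn => // i2; exact: s2.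
  move=> h; split => i /= iF.
    have /h /= : i \in undup (F1 ++ F2) by rewrite mem_undup mem_cat iF.
    by rewrite iF => -[].
  have /h /= : i \in undup (F1 ++ F2) by rewrite mem_undup mem_cat iF orbT.
  by rewrite iF => -[].
move=> B mB; apply: (@measure_unique _ R (seqsp I S) G (fun=> setT) mG GI) => //.
- by rewrite bigcup_const.
- by move=> _ [F [A [uF mA ->]]]; rewrite h1 // h2.
- move=> _; have := h1 [::] (fun=> setT) isT (fun=> measurableT).
  by rewrite !big_nil => ->; rewrite ltry.
Qed.

Lemma iid_family_law (d : measure_display) (T : measurableType d) (I : choiceType)
    (P : probability T R) (mu : probability S R) (X : I -> T -> S) :
  (forall i, measurable_fun setT (X i)) -> iid_family P mu X ->
  exists nu : probability (seqsp I S) R,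
    (forall A, nu A = P ((fun w => X^~ w) @^-1` A)) /\
    iid_family nu mu (fun i (s : seqsp I S) => s i).
Proof.
move=> mX hX.
have mX' : measurable_fun setT ((fun w => X^~ w) : T -> seqsp I S).
  exact: measurable_to_seqsp.
pose M := isMeasurableFun.Build _ _ _ _ _ mX'.
pose f : {mfun T >-> seqsp I S} := HB.pack (fun w => X^~ w) M.
exists (distribution P f); split => // F A uF mA.
rewrite -(hX F A uF mA) /distribution /pushforward; congr (P _).
by rewrite -!bigcap_seq; apply/seteqP; split.
Qed.

(** Both sides are integrals of [f] against the law of the family on [seqsp I S], which [mu]
    determines. Resampling and decoupling both rest on this exchange. *)
Lemma iid_family_transfer (d d' : measure_display) (T : measurableType d)
    (T' : measurableType d') (I : choiceType)
    (P : probability T R) (P' : probability T' R) (mu : probability S R)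
    (X : I -> T -> S) (X' : I -> T' -> S) (f : seqsp I S -> \bar R) :
  (forall i, measurable_fun setT (X i)) -> iid_family P mu X ->
  (forall i, measurable_fun setT (X' i)) -> iid_family P' mu X' ->
  measurable_fun setT f -> (forall s, (0 <= f s)%E) ->
  (\int[P]_w f (X^~ w) = \int[P']_w f (X'^~ w))%E.
Proof.
move=> mX hX mX' hX' mf f0.
have m1 : measurable_fun setT ((fun w => X^~ w) : T -> seqsp I S).
  exact: measurable_to_seqsp.
have m2 : measurable_fun setT ((fun w => X'^~ w) : T' -> seqsp I S).
  exact: measurable_to_seqsp.
have [nu1 [e1 i1]] := iid_family_law mX hX.
have [nu2 [e2 i2]] := iid_family_law mX' hX'.
have E1 : (\int[P]_w f (X^~ w) = \int[nu1]_s f s)%E.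
  rewrite (@eq_measure_integral _ _ _ setT (pushforward P ((fun w => X^~ w) : T -> seqsp I S)) nu1); last first.
    by move=> A mA _ /=; exact: e1.
  by rewrite ge0_integral_pushforward.
have E2 : (\int[P']_w f (X'^~ w) = \int[nu2]_s f s)%E.
  rewrite (@eq_measure_integral _ _ _ setT (pushforward P' ((fun w => X'^~ w) : T' -> seqsp I S)) nu2); last first.
    by move=> A mA _ /=; exact: e2.
  by rewrite ge0_integral_pushforward.
rewrite E1 E2; apply: eq_measure_integral => A mA _ /=.
exact: (iid_family_law_unique i1 i2).
Qed.

Lemma iid_family_comp (d : measure_display) (T : measurableType d) (I J : choiceType)
    (P : probability T R) (mu : probability S R) (X : I -> T -> S) (f : J -> I) :
  injective f -> iid_family P mu X -> iid_family P mu (X \o f).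
Proof.
move=> injf hX F A uF mA.
(* [A] is carried along [f], injectivity making the chosen preimage the right one; the default
   [setT] only occurs off the range of [f]. *)
pose A' i := if pselect (exists j, f j = i) is left h then A (projT1 (cid h))
             else setT.
have A'f j : A' (f j) = A j.
  rewrite /A'; case: pselect => [h|[]]; last by exists j.
  by case: cid => j' /= /injf ->.
have mA' i : measurable (A' i) by rewrite /A'; case: pselect.
have uF' : uniq (map f F) by rewrite map_inj_uniq.
have := hX _ A' uF' mA'; rewrite !big_map.
by under eq_bigr do rewrite A'f; under [in RHS]eq_bigr do rewrite A'f.
Qed.

Lemma measurable_upd (I : choiceType) (k : I) :
  measurable_fun setT ((fun p : seqsp I S * S => upd p.1 k p.2) :
                       seqsp I S * S -> seqsp I S).
Proof.
apply: measurable_to_seqsp => i; rewrite /upd; case: (i == k).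
  exact: measurable_snd.
exact: (measurableT_comp (measurable_coord i) measurable_fst).
Qed.

Lemma measurable_upd1 (I : choiceType) (k : I) (s : seqsp I S) :
  measurable_fun setT ((fun z : S => upd s k z) : S -> seqsp I S).
Proof.
apply: measurable_to_seqsp => i; rewrite /upd; case: (i == k) => //.
Qed.

(** A finite-dimensional event is a rectangle for [nu \x mu]: the coordinates other than [k]
    constrain [s], and coordinate [k], if listed, constrains only the fresh draw [z]. *)
Lemma iid_family_upd (I : choiceType) (nu : probability (seqsp I S) R)
    (mu : probability S R) (k : I) :
  iid_family nu mu (fun i (s : seqsp I S) => s i) ->
  iid_family ((nu \x mu)%E) mu
    (fun i (p : seqsp I S * S) => upd p.1 k p.2 i).
Proof.
move=> h F A uF mA.
have coordP (F' : seq I) : measurable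
    (\big[setI/setT]_(i <- F') ((fun s : seqsp I S => s i) @^-1` A i)).
  apply: bigsetI_measurable => i _.
  by rewrite -[X in measurable X]setTI; exact: measurable_coord.
have [kF|kF] := boolP (k \in F); last first.
  rewrite (_ : \big[setI/setT]_(i <- F) _ =
    (\big[setI/setT]_(i <- F) ((fun s : seqsp I S => s i) @^-1` A i)) `*` setT).
    rewrite /= product_measure1E // h //.
    by rewrite [X in (_ * X)%E](_ : _ = 1%E) ?mule1 //; exact: probability_setT.
  rewrite -!bigcap_seq; apply/seteqP; split => [[s z] /= H|[s z] /= [H _]].
    split => // i /= iF; have := H i iF; rewrite /upd/=.
    by case: eqP => // ik; rewrite -ik iF in kF.
  move=> i /= iF; rewrite /upd/=; case: eqP => [ik|_]; last exact: H.
  by rewrite -ik iF in kF.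
rewrite (_ : \big[setI/setT]_(i <- F) _ =
  (\big[setI/setT]_(i <- rem k F) ((fun s : seqsp I S => s i) @^-1` A i)) `*` A k).
  rewrite /= product_measure1E // h ?rem_uniq //.
  by rewrite (perm_big _ (perm_to_rem kF)) big_cons muleC.
rewrite -!bigcap_seq; apply/seteqP; split => [[s z] /= H|[s z] /= [H Hz]].
  split; last by have := H k kF; rewrite /upd/= eqxx.
  move=> i /=; rewrite mem_rem_uniq // inE => /andP[ik iF].
  by have := H i iF; rewrite /upd /= (negbTE ik).
move=> i /= iF; rewrite /upd/=; case: eqP => [->//|/eqP ik].
by apply: H => /=; rewrite mem_rem_uniq // inE ik.
Qed.

Section Resampling.
Context {I : choiceType} {nu : probability (seqsp I S) R} {mu : probability S R}.
Hypothesis inu : iid_family nu mu (fun i (s : seqsp I S) => s i).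
Variable k : I.

(** By [iid_family_upd], redrawing coordinate [k] leaves the law of the family unchanged. *)
Lemma resample_prod (f : seqsp I S -> \bar R) :
  measurable_fun setT f -> (forall s, (0 <= f s)%E) ->
  (\int[nu]_s f s = \int[(nu \x mu)%E]_p f (upd p.1 k p.2))%E.
Proof.
move=> mf f0.
have := @iid_family_transfer _ _ _ (seqsp I S * S)%type _ nu (nu \x mu)%E mu
  (fun i (s : seqsp I S) => s i) (fun i p => upd p.1 k p.2 i) f.
apply => //; first by move=> i; exact: measurable_coord.
  move=> i; have := measurableT_comp (measurable_coord i) (measurable_upd k).
  exact.
exact: iid_family_upd.
Qed.

Lemma resample (f : seqsp I S -> \bar R) :
  measurable_fun setT f -> (forall s, (0 <= f s)%E) ->
  (\int[nu]_s f s = \int[nu]_s \int[mu]_z f (upd s k z))%E.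
Proof.
move=> mf f0; rewrite resample_prod // fubini_tonelli1 //.
exact: (measurableT_comp mf (measurable_upd k)).
Qed.

Lemma integrable_upd (f : seqsp I S -> \bar R) : nu.-integrable setT f ->
  (nu \x mu)%E.-integrable setT (fun p => f (upd p.1 k p.2)).
Proof.
move=> /integrableP[mf fi]; apply/integrableP; split.
  exact: (measurableT_comp mf (measurable_upd k)).
rewrite -(@resample_prod (fun s => `|f s|%E)) //.
exact: measurableT_comp mf.
Qed.

Lemma resample_integrable (f : seqsp I S -> \bar R) : nu.-integrable setT f ->
  (\int[nu]_s f s = \int[nu]_s \int[mu]_z f (upd s k z))%E.
Proof.
move=> fi; have mf := measurable_int _ fi.
rewrite -[RHS]/(\int[nu]_s fubini_F mu (fun p : seqsp I S * S => f (upd p.1 k p.2)) s)%E.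
rewrite (integral12_prod_meas1 (integrable_upd fi)) integralE [RHS]integralE.
congr (_ - _)%E.
  rewrite (@resample_prod f^\+%E) //; last exact: measurable_funepos.
  by apply: eq_integral => p _; rewrite !funeposE.
rewrite (@resample_prod f^\-%E) //; last exact: measurable_funeneg.
by apply: eq_integral => p _; rewrite !funenegE.
Qed.

End Resampling.

End SequenceSpace.

(** * Inner products and weak measurability in a separable space *)

Section InnerProduct.
Context {R : realType} {H : normedModType R} {inner : H -> H -> R}.
Hypothesis ip : is_inner_product inner.

Lemma innerC x y : inner x y = inner y x.
Proof. by case: ip. Qed.

Lemma inner0l z : inner 0 z = 0.
Proof.
case: ip => _ L _ _; have := L 1 0 0 z.
by rewrite scaler0 addr0 mul1r => /eqP; rewrite -subr_eq0 opprD addNKr oppr_eq0 => /eqP.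
Qed.

Lemma innerDl x y z : inner (x + y) z = inner x z + inner y z.
Proof. by case: ip => _ L _ _; have := L 1 x y z; rewrite scale1r mul1r. Qed.

Lemma innerZl a x z : inner (a *: x) z = a * inner x z.
Proof. by case: ip => _ L _ _; have := L a x 0 z; rewrite !addr0 inner0l addr0. Qed.

Lemma innerNl x z : inner (- x) z = - inner x z.
Proof. by rewrite -scaleN1r innerZl mulN1r. Qed.

Lemma innerDr x y z : inner z (x + y) = inner z x + inner z y.
Proof. by rewrite innerC innerDl !(innerC _ z). Qed.

Lemma innerZr a x z : inner z (a *: x) = a * inner z x.
Proof. by rewrite innerC innerZl (innerC _ z). Qed.

Lemma innerNr x z : inner z (- x) = - inner z x.
Proof. by rewrite innerC innerNl (innerC _ z). Qed.

Lemma inner_suml (I : Type) (r : seq I) (F : I -> H) v :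
  inner (\sum_(i <- r) F i) v = \sum_(i <- r) inner (F i) v.
Proof.
elim: r => [|i r IH]; first by rewrite !big_nil inner0l.
by rewrite !big_cons innerDl IH.
Qed.

Lemma innerxx x : inner x x = `|x| ^+ 2.
Proof. by case: ip => _ _ P N; rewrite N sqr_sqrtr. Qed.

Lemma sqr_normD x y : `|x + y| ^+ 2 = `|x| ^+ 2 + 2 * inner x y + `|y| ^+ 2.
Proof. by rewrite -!innerxx innerDl !innerDr (innerC y x); ring. Qed.

Lemma sqr_normB x y : `|x - y| ^+ 2 = `|x| ^+ 2 - 2 * inner x y + `|y| ^+ 2.
Proof. by rewrite sqr_normD innerNr normrN mulrN. Qed.

(** Cauchy-Schwarz: the squared norm of [|y| ^ 2 *: x - inner x y *: y] is nonnegative, and a factor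
    [|y| ^ 2] cancels from its expansion. *)
Lemma sqr_inner_le x y : inner x y ^+ 2 <= `|x| ^+ 2 * `|y| ^+ 2.
Proof.
have [->|y0] := eqVneq y 0.
  by rewrite innerC inner0l normr0 expr0n mulr0.
have yp : 0 < `|y| ^+ 2 by rewrite exprn_gt0 // normr_gt0.
rewrite -subr_ge0 -(pmulr_rge0 _ yp).
suff -> : `|y| ^+ 2 * (`|x| ^+ 2 * `|y| ^+ 2 - inner x y ^+ 2) =
          `| `|y| ^+ 2 *: x - inner x y *: y| ^+ 2 by exact: sqr_ge0.
rewrite sqr_normB innerZl innerZr !normrZ !exprMn !real_normK ?num_real //.
ring.
Qed.

Lemma inner_le x y : `|inner x y| <= `|x| * `|y|.
Proof.
rewrite -(@ler_pXn2r _ 2) ?nnegrE ?mulr_ge0 //.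
by rewrite real_normK ?num_real // exprMn sqr_inner_le.
Qed.

Lemma open_inner_gt (v : H) (c : R) : open [set x | c < inner x v].
Proof.
rewrite openE => x /= xc; rewrite /interior.
have p : 0 < (inner x v - c) / (`|v| + 1).
  by rewrite divr_gt0 ?subr_gt0 // ltr_wpDl.
apply/nbhs_normP; exists ((inner x v - c) / (`|v| + 1)) => //= y /= xy.
have vp : 0 < `|v| + 1 by rewrite ltr_wpDl.
move: xy; rewrite ltr_pdivlMr // => xy.
have := inner_le (x - y) v; rewrite innerDl innerNl => /(le_trans (ler_norm _)) h.
have : `|x - y| * `|v| <= `|x - y| * (`|v| + 1) by rewrite ler_wpM2l // lerDl.
by lra.
Qed.

(** Scalar measurability passes to linear combinations by bilinearity alone, and in a separable
    space it still makes the norm measurable. *)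
Definition weakly_measurable (d : measure_display) (T : measurableType d)
    (f : T -> H) :=
  forall v, measurable_fun setT (fun w => inner (f w) v).

Lemma weakly_measurable_borel (d : measure_display) (T : measurableType d)
    (f : T -> H) :
  (forall U, borel_sets U -> measurable (f @^-1` U)) -> weakly_measurable f.
Proof.
move=> mf v; apply: (measurability _ (RGenOInfty.measurableE R)) => //.
move=> _ [_ [c ->] <-]; rewrite setTI.
rewrite (_ : _ @^-1` _ = f @^-1` [set x | c < inner x v]).
  by apply: mf; apply: sub_sigma_algebra; exact: open_inner_gt.
by apply/seteqP; split => w /=; rewrite in_itv /= andbT.
Qed.

Section WeakMeasurability.
Context {d : measure_display} {T : measurableType d}.
Implicit Type f g : T -> H.

Lemma weakly_measurable0 : weakly_measurable (fun _ : T => 0 : H).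
Proof. by move=> v; exact: measurable_cst. Qed.

Lemma weakly_measurableD f g : weakly_measurable f -> weakly_measurable g ->
  weakly_measurable (fun w => f w + g w).
Proof.
move=> mf mg v; under eq_fun do rewrite innerDl.
exact: measurable_funD.
Qed.

Lemma weakly_measurableZ (c : R) f : weakly_measurable f ->
  weakly_measurable (fun w => c *: f w).
Proof.
move=> mf v; under eq_fun do rewrite innerZl.
exact: measurable_funM.
Qed.

Lemma weakly_measurable_sum (I : Type) (r : seq I) (F : I -> T -> H) :
  (forall i, weakly_measurable (F i)) ->
  weakly_measurable (fun w => \sum_(i <- r) F i w).
Proof.
move=> mF v; under eq_fun do rewrite inner_suml.
by apply: measurable_sum => i; exact: mF.
Qed.

Lemma weakly_measurable_comp (d' : measure_display) (T' : measurableType d')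
    f (phi : T' -> T) : measurable_fun setT phi -> weakly_measurable f ->
  weakly_measurable (f \o phi).
Proof. by move=> mphi mf v; exact: (measurableT_comp (mf v) mphi). Qed.

End WeakMeasurability.

Hypothesis sep : separable_space H.

Lemma dense_sequence : exists e : nat -> H,
  forall x (r : R), 0 < r -> exists n, `|x - e n| < r.
Proof.
have [D [cD clD]] := sep.
have [f injf] := countable_injP D cD.
(* [f] numbers the dense set injectively; numbers that are not attained receive the value 0. *)
exists (fun n => if pselect (exists x, D x /\ f x = n) is left h
                 then projT1 (cid h) else 0) => x r r0.
have : closure D x by rewrite clD.
move=> /(_ _ (nbhsx_ballx x r r0)) [y [Dy]].
rewrite -ball_normE /= => xy; exists (f y).
case: pselect => [h|[]]; last by exists y.
case: cid => z /= [Dz] /injf; rewrite !inE => -> //.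
Qed.

(** For [c >= 0], the event [|f| > c] is the countable union over a dense sequence of the events
    [c * |e n| < inner f (e n)]: one inclusion is Cauchy-Schwarz, the other takes [e n] close to the
    value of [f]. *)
Lemma measurable_norm_weak (d : measure_display) (T : measurableType d)
    (f : T -> H) : weakly_measurable f -> measurable_fun setT (fun w => `|f w|).
Proof.
move=> mf; have [e he] := dense_sequence.
apply: (measurability _ (RGenOInfty.measurableE R)) => //.
move=> _ [_ [c ->] <-]; rewrite setTI.
have [c0|c0] := ltP c 0.
  rewrite (_ : _ @^-1` _ = setT) //.
  apply/seteqP; split => w //= _; rewrite in_itv /= andbT.
  exact: lt_le_trans c0 _.
rewrite (_ : _ @^-1` _ = \bigcup_n [set w | c * `|e n| < inner (f w) (e n)]).
  apply: bigcup_measurable => n _.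
  rewrite (_ : [set _ | _] = setT `&` (fun w => inner (f w) (e n)) @^-1` `]c * `|e n|, +oo[).
    exact: mf.
  by rewrite setTI; apply/seteqP; split => w /=; rewrite in_itv /= andbT.
apply/seteqP; split => w /=; rewrite in_itv /= andbT; last first.
  move=> [n _ /= h].
  have /lt_le_trans := h; move=> /(_ _ (le_trans (ler_norm _) (inner_le _ _))) h2.
  rewrite -subr_gt0 -mulrBl in h2.
  have n0 : 0 < `|e n|.
    rewrite lt_neqAle normr_ge0 andbT; apply/eqP => n0.
    by move: h2; rewrite -n0 mulr0 ltxx.
  by rewrite pmulr_lgt0 // subr_gt0 in h2.
move=> h; set x := f w in h *.
have x0 : 0 < `|x| by exact: le_lt_trans h.
(* Half the gap suffices: the error [(|x| + c) * r] is then at most [|x| * (|x| - c)], because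
   [c < |x|]. *)
pose r := (`|x| - c) / 2 .
have r0 : 0 < r by rewrite /r; lra.
have [n hn] := he x r r0; exists n => //=.
have : inner x (e n) = `|x| ^+ 2 - inner x (x - e n).
  by rewrite innerDr innerNr innerxx; ring.
rewrite -/x => ->.
have A := le_trans (ler_norm _) (inner_le x (x - e n)).
have B : `|e n| <= `|x| + `|x - e n|.
  rewrite -[X in `|X| <= _](_ : x - (x - e n) = e n) ?ler_normB //.
  by rewrite opprD addNKr opprK.
have C : c * `|e n| <= c * (`|x| + `|x - e n|) by rewrite ler_wpM2l.
have E : (`|x| + c) * `|x - e n| < (`|x| + c) * r by rewrite ltr_pM2l // ltr_wpDr.
have : (`|x| + c) * r <= `|x| * (`|x| - c) by rewrite /r; nra.
nra.
Qed.

End InnerProduct.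

(** * Centered random vectors and convexity of the excess *)

Section CenteredVectors.
Context {R : realType} {H : normedModType R} {inner : H -> H -> R}.
Hypothesis ip : is_inner_product inner.
Hypothesis sep : separable_space H.
Context {d : measure_display} {S : measurableType d} (mu : probability S R).

(** The mean is zero in the weak sense, so that only scalar integrals occur. *)
Definition centered (b : S -> H) :=
  [/\ weakly_measurable (inner := inner) b,
      (\int[mu]_z (`|b z|)%:E < +oo)%E &
      forall v, (\int[mu]_z (inner (b z) v)%:E = 0)%E].

Let measurable_normb (b : S -> H) : weakly_measurable (inner := inner) b ->
  measurable_fun setT (fun z => (`|b z|)%:E).
Proof. by move=> mb; apply/measurable_EFinP; exact: measurable_norm_weak mb. Qed.

Lemma integrable_inner (b : S -> H) v : weakly_measurable (inner := inner) b ->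
  (\int[mu]_z (`|b z|)%:E < +oo)%E ->
  mu.-integrable setT (fun z => (inner (b z) v)%:E).
Proof.
move=> mb ib; apply: (@le_integrable _ _ _ _ _ measurableT _
    (fun z => (`|v| * `|b z|)%:E)).
- by apply/measurable_EFinP; exact: mb.
- move=> z _ /=; rewrite lee_fin (le_trans (inner_le ip _ _)) //.
  by rewrite mulrC ger0_norm // mulr_ge0.
- under eq_fun do rewrite EFinM; apply: integrableZl => //.
  apply/integrableP; split; first exact: measurable_normb.
  by under eq_integral do rewrite gee0_abs ?lee_fin //.
Qed.

Lemma centered0 : centered (fun=> 0).
Proof.
split; first exact: weakly_measurable0.
  by rewrite normr0 integral0 ltry.
by move=> v; rewrite (inner0l ip) integral0.
Qed.

Lemma centeredD b1 b2 : centered b1 -> centered b2 ->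
  centered (fun z => b1 z + b2 z).
Proof.
move=> [m1 i1 c1] [m2 i2 c2]; have m12 := weakly_measurableD ip m1 m2.
split => //.
  apply: le_lt_trans (lte_add_pinfty i1 i2).
  rewrite -ge0_integralD //; [|exact: measurable_normb..].
  apply: ge0_le_integral => //; first exact: measurable_normb.
    by apply: emeasurable_funD; exact: measurable_normb.
  by move=> z _; rewrite -EFinD lee_fin ler_normD.
move=> v; under eq_integral do rewrite (innerDl ip) EFinD.
rewrite integralD //; [|exact: integrable_inner..].
by rewrite c1 c2 adde0.
Qed.

Lemma centeredZ (c : R) b : centered b -> centered (fun z => c *: b z).
Proof.
move=> [mb ib cb]; split; first exact: weakly_measurableZ.
  under eq_integral do rewrite normrZ EFinM.
  rewrite ge0_integralZl //; last exact: measurable_normb.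
  by rewrite lte_mul_pinfty.
move=> v; under eq_integral do rewrite (innerZl ip) EFinM.
by rewrite integralZl ?cb ?mule0 //; exact: integrable_inner.
Qed.

Lemma centered_sum (I : eqType) (r : seq I) (F : I -> S -> H) :
  (forall i, i \in r -> centered (F i)) ->
  centered (fun z => \sum_(i <- r) F i z).
Proof.
elim: r => [|i r IH] h.
  by under eq_fun do rewrite big_nil; exact: centered0.
under eq_fun do rewrite big_cons; apply: centeredD.
  by apply: h; rewrite mem_head.
by apply: IH => j jr; apply: h; rewrite inE jr orbT.
Qed.

Definition excess (a t : R) : R := Num.max (t - a) 0.

Lemma excess_ge0 a t : 0 <= excess a t.
Proof. by rewrite /excess le_max lexx orbT. Qed.

Lemma excess_convex a s t r : 2 * r <= s + t -> 2 * excess a r <= excess a s + excess a t.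
Proof.
move=> h; have := excess_ge0 a s; have := excess_ge0 a t.
have [A B] : s - a <= excess a s /\ t - a <= excess a t.
  by rewrite /excess !le_max !lexx.
by rewrite {3}/excess; case: (leP (r - a) 0) => //= *; lra.
Qed.

Lemma measurable_excess (d' : measure_display) (T : measurableType d') (f : T -> R) a :
  measurable_fun setT f -> measurable_fun setT (fun w => excess a (f w)).
Proof.
move=> mf; apply: measurable_maxr; last exact: measurable_cst.
exact: measurable_funB.
Qed.

(** Jensen's inequality by a supporting functional: if [|u| > a] and [e = u / |u|], then
    [inner (u + b z) e - a] lies below the excess of [u + b z] and integrates to [|u| - a]. *)
Lemma excess_le_integral (a : R) (b : S -> H) (u : H) : 0 < a -> centered b ->
  ((excess a `|u|)%:E <= \int[mu]_z (excess a `|(u + b z)%R|)%:E)%E.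
Proof.
move=> a0 cb; have [mb ib cb0] := cb.
have [ua|au] := leP `|u| a.
  rewrite /excess max_r ?subr_le0 //; apply: integral_ge0 => z _.
  by rewrite lee_fin excess_ge0.
have u0 : 0 < `|u| by exact: lt_trans au.
pose e := `|u|^-1 *: u.
have ne : `|e| = 1 by rewrite normrZ gtr0_norm ?invr_gt0 // mulVf ?gt_eqF.
have ue : inner u e = `|u|.
  by rewrite (innerZr ip) (innerxx ip) expr2 mulrA mulVf ?gt_eqF // mul1r.
have mub : weakly_measurable (inner := inner) (fun z => u + b z).
  by apply: weakly_measurableD => // v; exact: measurable_cst.
have -> : (excess a `|u|)%:E =
    (\int[mu]_z ((inner (b z) e)%:E + (`|u| - a)%:E))%E.
  rewrite integralD //; last 2 first.
  - exact: integrable_inner.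
  - by apply: finite_measure_integrable_cst.
  rewrite cb0 add0e integral_cst //.
  rewrite [X in (_ * X)%E](_ : _ = 1%E) ?mule1; last exact: probability_setT.
  by rewrite /excess max_l // subr_ge0 ltW.
apply: le_integral => //.
- apply: integrableD => //; first exact: integrable_inner.
  by apply: finite_measure_integrable_cst.
- apply: (@le_integrable _ _ _ _ _ measurableT _
    (fun z => (`|u|)%:E + (`|b z|)%:E)%E).
  + apply/measurable_EFinP/measurable_excess.
    exact: measurable_norm_weak mub.
  + move=> z _; rewrite -EFinD /= lee_fin ger0_norm ?excess_ge0 //.
    rewrite ger0_norm ?addr_ge0 //.
    rewrite /excess ge_max addr_ge0 // andbT.
    by have := ler_normD u (b z); lra.
  + apply: integrableD => //; first exact: finite_measure_integrable_cst.
    apply/integrableP; split; first exact: measurable_normb.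
    by under eq_integral do rewrite gee0_abs ?lee_fin //.
- move=> z _; rewrite -EFinD lee_fin /excess le_max; apply/orP; left.
  have := le_trans (ler_norm _) (inner_le ip (u + b z) e).
  by rewrite ne mulr1 (innerDl ip) ue; lra.
Qed.

(** [u + b] is the midpoint of [u + 2 *: b] and [u]. This is the source of the factor 2 per
    symmetrised variable. *)
Lemma excess_symm (a : R) (u b : H) :
  2 * excess a `|u + b| <= excess a `|u + 2 *: b| + excess a `|u|.
Proof.
apply: excess_convex; have -> : 2 * `|u + b| = `|(u + 2 *: b) + u|.
  rewrite -[in LHS](@ger0_norm _ 2) // -normrZ scalerDr !scaler_nat !mulr2n.
  by rewrite addrAC.
exact: ler_normD.
Qed.

End CenteredVectors.

(** * From vanishing conditional expectations to centered sections *)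

Section CenteredKernel.
Context {R : realType} {H : normedModType R} {inner : H -> H -> R}.
Hypothesis ip : is_inner_product inner.
Hypothesis sep : separable_space H.
Context {d : measure_display} {S : measurableType d}.

(** The integral is Lipschitz in [v], with constant the integral of [|b|]. Testing on a sequence
    only keeps the exceptional null sets countable in number. *)
Lemma inner_integral_eq0 (mu : probability S R) (b : S -> H) (e : nat -> H) :
  (forall x (r : R), 0 < r -> exists n, `|x - e n| < r) ->
  weakly_measurable (inner := inner) b -> (\int[mu]_z (`|b z|)%:E < +oo)%E ->
  (forall n, (\int[mu]_z (inner (b z) (e n))%:E = 0)%E) ->
  forall v, (\int[mu]_z (inner (b z) v)%:E = 0)%E.
Proof.
move=> he mb ib h0 v.
have mnb : measurable_fun setT (fun z => (`|b z|)%:E).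
  by apply/measurable_EFinP; exact: measurable_norm_weak mb.
have key n : (`|\int[mu]_z (inner (b z) v)%:E| <=
              (`|v - e n|)%:E * \int[mu]_z (`|b z|)%:E)%E.
  have -> : (\int[mu]_z (inner (b z) v)%:E =
             \int[mu]_z (inner (b z) (v - e n))%:E)%E.
    rewrite -[RHS]adde0 -[X in (_ + X)%E](h0 n) -integralD //;
      [|exact: integrable_inner..].
    apply: eq_integral => z _.
    by rewrite -EFinD -(innerDr ip) subrK.
  apply: le_trans (le_abse_integral _ _ _) _ => //.
    exact/measurable_EFinP/mb.
  rewrite -ge0_integralZl //.
  apply: ge0_le_integral => //.
  - apply: measurableT_comp => //; exact/measurable_EFinP/mb.
  - exact: measurable_funeM.
  - move=> z _; rewrite -EFinM /= lee_fin mulrC; exact: inner_le ip _ _.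
have fK : (\int[mu]_z (`|b z|)%:E)%E \is a fin_num.
  by rewrite ge0_fin_numE //; apply: integral_ge0.
have fc : (\int[mu]_z (inner (b z) v)%:E)%E \is a fin_num.
  by apply: integrable_fin_num => //; exact: integrable_inner.
move: key; rewrite -(fineK fK) -(fineK fc).
set c := fine _; set K := fine _ => key.
have K0 : 0 <= K by rewrite /K fine_ge0 // integral_ge0.
congr EFin; apply/eqP; apply: contraT => c0.
have cp : 0 < `|c| by rewrite normr_gt0.
(* The radius makes [|v - e n| * K] smaller than [|c|]; [K + 1] guards against [K = 0]. *)
have r0 : 0 < `|c| / (K + 1) by rewrite divr_gt0 // ltr_wpDl.
have [n hn] := he v _ r0.
have := key n; rewrite -EFinM lee_fin => h.
rewrite ltr_pdivlMr ?ltr_wpDl // in hn.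
have : `|v - e n| * K <= `|v - e n| * (K + 1) by rewrite ler_wpM2l // lerDl.
by lra.
Qed.

Context {I : choiceType} {nu : probability (seqsp I S) R} {mu : probability S R}.
Hypothesis inu : iid_family nu mu (fun i (s : seqsp I S) => s i).

Lemma upd_upd (T : Type) (s : I -> T) k z z' : upd (upd s k z) k z' = upd s k z'.
Proof. by apply/funext => i; rewrite /upd; case: eqP. Qed.

(** Invariance under overwriting coordinate [k] stands for measurability with respect to the other
    coordinates. *)
Definition upd_invariant (k : I) (G : set (seqsp I S)) :=
  forall s z, G (upd s k z) <-> G s.

(** [phi], the average of [f] over coordinate [k], is a version of the conditional expectation given
    the other coordinates. The sets where [phi >= 0] and where [phi <= 0] are invariant, and on each
    of them the integral of [|phi|] is, up to sign, that of [phi], hence 0. *)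
Lemma ae_resample_eq0 (k : I) (f : seqsp I S -> R) :
  nu.-integrable setT (EFin \o f) ->
  (forall G, measurable G -> upd_invariant k G ->
     (\int[nu]_(s in G) (f s)%:E = 0)%E) ->
  {ae nu, forall s, (\int[mu]_z (f (upd s k z))%:E = 0)%E}.
Proof.
move=> fi hf.
have mf := measurable_int _ fi.
pose phi := fubini_F mu (fun p : seqsp I S * S => (f (upd p.1 k p.2))%:E).
have iu := integrable_upd inu k fi.
have iphi : nu.-integrable setT phi by exact: integrable_fubini_F iu.
have mphi := measurable_int _ iphi.
have phi_upd s z : phi (upd s k z) = phi s.
  by rewrite /phi /fubini_F /=; under eq_integral do rewrite upd_upd.
have intG G : measurable G -> upd_invariant k G ->
    (\int[nu]_(s in G) phi s = 0)%E.
  move=> mG iG; rewrite -[RHS](hf G mG iG) integral_mkcond [RHS]integral_mkcond.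
  rewrite [RHS](resample_integrable inu k); last first.
    apply/(@integrable_mkcond _ _ _ nu G (EFin \o f) mG).
    exact: (integrableS measurableT mG (@subsetT _ G) fi).
  apply: eq_integral => s _; rewrite patchE.
  case: ifPn => [|] sG.
    apply: eq_integral => z _; rewrite patchE mem_set //.
    by apply/(iG s z); rewrite inE in sG.
  rewrite integral0_eq // => z _; rewrite patchE memNset //.
  by move/(iG s z) => sG'; rewrite mem_set in sG.
have nullG G : measurable G -> upd_invariant k G ->
    (forall s, G s -> `|phi s| = phi s)%E \/ (forall s, G s -> `|phi s| = - phi s)%E ->
    {ae nu, forall s, G s -> phi s = 0%E}.
  move=> mG iG h; apply/(ae_eq_integral_abs nu mG); first exact: measurable_funTS.
  case: h => h.
    by under eq_integral => s /[!inE] sG do rewrite h //; exact: intG.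
  under eq_integral => s /[!inE] sG do rewrite h //.
  rewrite integralN ?intG ?oppe0 //.
  rewrite fin_num_adde_defl //.
  rewrite fin_numN integrable_neg_fin_num //.
  exact: (integrableS measurableT mG (@subsetT _ G) iphi).
have mP : measurable [set s | (0 <= phi s)%E].
  by rewrite -[X in measurable X]setTI; apply: emeasurable_fun_c_infty.
have mN : measurable [set s | (phi s <= 0)%E].
  by rewrite -[X in measurable X]setTI; apply: emeasurable_fun_infty_c.
have aeP := nullG _ mP (fun s z => ltac:(rewrite /= phi_upd; split; exact id))
  (or_introl (fun s h => gee0_abs h)).
have aeN := nullG _ mN (fun s z => ltac:(rewrite /= phi_upd; split; exact id))
  (or_intror (fun s h => lee0_abs h)).
apply: filterS2 aeP aeN => s hP hN.
rewrite -[LHS]/(phi s).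
by have [/hP|/ltW/hN] := leP 0%E (phi s).
Qed.

(** The null sets attached to the vectors [e n] are joined to the one off which the norm of the
    section is integrable; density then handles all [v] at once. *)
Lemma ae_centered_kernel (k : I) (g : seqsp I S -> H) :
  weakly_measurable (inner := inner) g ->
  (\int[nu]_s (`|g s|)%:E < +oo)%E ->
  (forall v G, measurable G -> upd_invariant k G ->
     (\int[nu]_(s in G) (inner (g s) v)%:E = 0)%E) ->
  {ae nu, forall s, centered (inner := inner) mu (fun z => g (upd s k z))}.
Proof.
move=> mg ig hg; have [e he] := dense_sequence sep.
have mng : measurable_fun setT (fun s => (`|g s|)%:E).
  by apply/measurable_EFinP; exact: measurable_norm_weak mg.
have ae1 n : {ae nu, forall s, (\int[mu]_z (inner (g (upd s k z)) (e n))%:E = 0)%E}.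
  apply: (@ae_resample_eq0 k (fun s => inner (g s) (e n))); last exact: hg.
  exact: integrable_inner.
have iF : nu.-integrable setT
    (fubini_F mu (fun p : seqsp I S * S => (`|g (upd p.1 k p.2)|)%:E)).
  apply: integrable_fubini_F.
  apply: (@integrable_upd _ _ _ _ _ _ inu k (fun s => (`|g s|)%:E)).
  apply/integrableP; split => //.
  by under eq_integral do rewrite gee0_abs ?lee_fin //.
have ae2 := integrable_ae measurableT iF.
have ae3 := ae_foralln ae1.
apply: filterS2 ae2 ae3 => s h2 h3.
have mgs : weakly_measurable (inner := inner) (fun z => g (upd s k z)).
  exact: (weakly_measurable_comp (measurable_upd1 k s) mg).
have ifin : (\int[mu]_z (`|g (upd s k z)|)%:E < +oo)%E.
  have := h2 Logic.I; rewrite /fubini_F /= ge0_fin_numE //.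
  by apply: integral_ge0 => z _; rewrite lee_fin.
split => //; exact: inner_integral_eq0 he mgs ifin h3.
Qed.

End CenteredKernel.

(** * Submartingale property, symmetrisation and maximal inequality for degenerate sums *)

Section DegenerateSums.
Context {R : realType} {H : normedModType R} {inner : H -> H -> R}.
Hypothesis ip : is_inner_product inner.
Hypothesis sep : separable_space H.
Context {d : measure_display} {S : measurableType d}.
Context {nu : probability (seqsp nat S) R} {mu : probability S R}.
Hypothesis inu : iid_family nu mu (fun i (s : seqsp nat S) => s i).
Context {J : eqType} (supp : J -> seq nat) (V : J -> seqsp nat S -> H) (M : seq J).
Hypothesis mV : forall t, t \in M -> weakly_measurable (inner := inner) (V t).
Hypothesis V_upd : forall t k s z, t \in M -> k \notin supp t ->
  V t (upd s k z) = V t s.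
Hypothesis V_centered : forall t k, t \in M -> k \in supp t ->
  {ae nu, forall s, centered (inner := inner) mu (fun z => V t (upd s k z))}.

Implicit Types (c : J -> R) (k n : nat) (s : seqsp nat S) (D : set (seqsp nat S)).

Definition wsum c s : H := \sum_(t <- M) c t *: V t s.

(** By degeneracy, [wsum (drop_index k c)] is the conditional expectation of [wsum c] given all the
    variables except the one of index [k]. *)
Definition drop_index k c t : R := if k \in supp t then 0 else c t.

Lemma weakly_measurable_wsum c : weakly_measurable (inner := inner) (wsum c).
Proof.
have -> : wsum c = fun s => \sum_(t <- M) if t \in M then c t *: V t s else 0.
  by apply/funext => s; rewrite /wsum big_seq [RHS]big_seq; apply: eq_bigr => t ->.
apply: (weakly_measurable_sum ip) => t; case tM: (t \in M).
  by apply: (weakly_measurableZ ip); exact: mV.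
exact: weakly_measurable0.
Qed.

Lemma measurable_excess_wsum a c :
  measurable_fun setT (fun s => (excess a `|wsum c s|)%:E).
Proof.
apply/measurable_EFinP/measurable_excess.
exact: (measurable_norm_weak ip sep (weakly_measurable_wsum c)).
Qed.

Lemma wsum_drop_upd k c s z :
  wsum (drop_index k c) (upd s k z) = wsum (drop_index k c) s.
Proof.
rewrite /wsum !big_seq; apply: eq_bigr => t tM; rewrite /drop_index.
by case: ifPn => kt; rewrite ?scale0r // V_upd.
Qed.

Lemma wsum_split k c s :
  wsum c s = wsum (drop_index k c) s +
             \sum_(t <- M | k \in supp t) c t *: V t s.
Proof.
rewrite /wsum (bigID (fun t => k \in supp t)) /= addrC; congr (_ + _).
rewrite [RHS](bigID (fun t => k \in supp t)) /=.
rewrite [X in _ = X + _]big1 ?add0r => [|t kt]; last by rewrite /drop_index kt scale0r.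
by apply: eq_bigr => t /negbTE kt; rewrite /drop_index kt.
Qed.

Lemma ae_centered_part k c :
  {ae nu, forall s, centered (inner := inner) mu
     (fun z => \sum_(t <- M | k \in supp t) c t *: V t (upd s k z))}.
Proof.
(* One null set per term of [M], collected by induction on a sublist so that membership in [M] stays
   available. *)
have aux (M' : seq J) : {subset M' <= M} -> {ae nu, forall s, forall t, t \in M' ->
    k \in supp t -> centered (inner := inner) mu (fun z => V t (upd s k z))}.
  elim: M' => [|t M' IH] sM; first by apply: aeW => s t; rewrite in_nil.
  have tM : t \in M by apply: sM; rewrite mem_head.
  have {IH}IH := IH (fun t' h => sM t' (mem_behead (s := t :: M') h)).
  have [kt|kt] := boolP (k \in supp t); last first.
    apply: filterS IH => s h t'; rewrite inE => /predU1P[->|/h//].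
    by rewrite (negbTE kt).
  apply: filterS2 IH (V_centered tM kt) => s h1 h2 t'.
  by rewrite inE => /predU1P[->//|/h1].
apply: filterS (aux M (fun t h => h)) => s h.
under eq_fun do rewrite -big_filter.
apply: (centered_sum ip sep) => t; rewrite mem_filter => /andP[kt tM].
by apply: (centeredZ ip sep); exact: h.
Qed.

(** Conditional Jensen: variable [k] is redrawn, which neither [D] nor the dropped sum can see, and
    [excess_le_integral] applies to the centered remainder. Both the symmetrisation and the maximal
    inequality use this step. *)
Lemma integral_excess_drop a k c D : 0 < a -> measurable D -> upd_invariant k D ->
  (\int[nu]_(s in D) (excess a `|wsum (drop_index k c) s|)%:E <=
   \int[nu]_(s in D) (excess a `|wsum c s|)%:E)%E.
Proof.
move=> a0 mD iD; rewrite integral_mkcond [leRHS]integral_mkcond.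
have mP c' : measurable_fun setT
    ((fun s => (excess a `|wsum c' s|)%:E) \_ D).
  apply/(measurable_restrictT (fun s => (excess a `|wsum c' s|)%:E) mD).
  by apply: measurable_funTS; exact: measurable_excess_wsum.
have P0 c' s : (0 <= ((fun s => (excess a `|wsum c' s|)%:E) \_ D) s)%E.
  by rewrite patchE; case: ifP => // _; rewrite lee_fin excess_ge0.
rewrite [leRHS](resample inu k) //.
apply: ae_ge0_le_integral => //.
- by move=> s _; apply: integral_ge0.
- apply: (measurable_fun_fubini_tonelli_F (fun p : seqsp nat S * S =>
      ((fun s => (excess a `|wsum c s|)%:E) \_ D) (upd p.1 k p.2))) => //=.
  exact: (measurableT_comp (mP c) (measurable_upd k)).
apply: filterS (ae_centered_part k c) => s hs _.
rewrite patchE; case: ifPn => sD; last first.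
  by apply: integral_ge0.
apply: le_trans (excess_le_integral ip sep _ a0 hs) _.
rewrite le_eqVlt; apply/orP; left; apply/eqP; apply: eq_integral => z _.
rewrite patchE mem_set; last by apply/(iD s z); rewrite inE in sD.
by rewrite (wsum_split k c (upd s k z)) wsum_drop_upd.
Qed.

(** Here [e] is meant to be a sign, and 2 is the price of symmetrising variable [k]. *)
Definition flip_index k (e : R) c t : R := if k \in supp t then 2 * e * c t else c t.

(** In [excess_symm], let [u] be the part of the sum without [k] and [b] the part with it:
    [u + 2 *: b] is the flip by 1, while [u] is also the flip by -1 with [k] dropped, so its excess
    is controlled by [integral_excess_drop]. *)
Lemma integral_excess_flip a k c : 0 < a ->
  (2%:E * \int[nu]_s (excess a `|wsum c s|)%:E <=
   \int[nu]_s (excess a `|wsum (flip_index k 1 c) s|)%:E +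
   \int[nu]_s (excess a `|wsum (flip_index k (-1) c) s|)%:E)%E.
Proof.
move=> a0.
have drop_flip e : drop_index k (flip_index k e c) = drop_index k c.
  by apply/funext => t; rewrite /drop_index /flip_index; case: (k \in supp t).
have := @integral_excess_drop a k (flip_index k (-1) c) setT a0 measurableT
  (fun s z => conj id id).
rewrite drop_flip => h.
apply: le_trans (leeD2l _ h).
have m c' := measurable_excess_wsum a c'.
have p c' s : setT s -> (0 <= (excess a `|wsum c' s|)%:E)%E.
  by rewrite lee_fin excess_ge0.
rewrite -(ge0_integralZl _ measurableT (m c) (p c)) // -ge0_integralD //; try exact: p.
apply: ge0_le_integral => //.
- by move=> s _; rewrite -EFinM lee_fin mulr_ge0 // excess_ge0.
- exact: measurable_funeM.
- exact: emeasurable_funD.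
move=> s _; rewrite -EFinM -EFinD lee_fin.
rewrite (wsum_split k c) (wsum_split k (flip_index k 1 c)) drop_flip.
rewrite (_ : \sum_(t <- M | k \in supp t) flip_index k 1 c t *: V t s =
  2 *: \sum_(t <- M | k \in supp t) c t *: V t s); first exact: excess_symm.
rewrite scaler_sumr; apply: eq_bigr => t kt.
by rewrite /flip_index kt mulr1 scalerA.
Qed.

(** Independent signs for the indices below [n], enumerated: a sum over this list is [2 ^ n] times
    an expectation over the signs. *)
Fixpoint sign_patterns n c : seq (J -> R) :=
  if n is n'.+1 then
    [seq flip_index n' e c' | c' <- sign_patterns n' c, e <- [:: 1; -1]]
  else [:: c].

Lemma big_sign_patternsS (A : Type) (idx : A) (op : Monoid.law idx) (F : (J -> R) -> A) n c :
  \big[op/idx]_(c' <- sign_patterns n.+1 c) F c' =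
  \big[op/idx]_(c' <- sign_patterns n c) op (F (flip_index n 1 c')) (F (flip_index n (-1) c')).
Proof.
by rewrite [LHS]big_allpairs_dep; apply: eq_bigr => c' _; rewrite big_cons big_seq1.
Qed.

Lemma integral_excess_sign_patterns a n c : 0 < a ->
  ((2 ^+ n)%:E * \int[nu]_s (excess a `|wsum c s|)%:E <=
   \sum_(c' <- sign_patterns n c) \int[nu]_s (excess a `|wsum c' s|)%:E)%E.
Proof.
move=> a0; elim: n => [|n IH]; first by rewrite expr0 mul1e big_seq1.
rewrite big_sign_patternsS exprS EFinM -muleA.
apply: (@le_trans _ _ (2%:E * \sum_(c' <- sign_patterns n c)
    \int[nu]_s (excess a `|wsum c' s|)%:E)%E).
  by rewrite lee_pmul2l.
rewrite ge0_sume_distrr; last first.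
  by move=> c' _; apply: integral_ge0 => s _; rewrite lee_fin excess_ge0.
by apply: lee_sum => c' _; exact: integral_excess_flip.
Qed.

(** Coefficients that turn [wsum] into the partial sum [U n]. Indices start at 0, so [k < n]
    corresponds to a tuple entry [k + 1 <= n]. *)
Definition below n (t : J) : R := (all (fun k => (k < n)%N) (supp t))%:R.

(** This is the martingale property: averaging over variable [n] sends [U (n + 1)] to [U n]. *)
Lemma drop_below n : drop_index n (below n.+1) = below n.
Proof.
apply/funext => t; rewrite /drop_index /below; case: ifPn => nt.
  by case: allP => // /(_ _ nt); rewrite ltnn.
congr ((nat_of_bool _)%:R); apply: eq_in_all.
move=> k kt /=; rewrite ltnS leq_eqVlt; case: eqP => // kn.
by rewrite -kn kt in nt.
Qed.

Lemma wsum_below_upd n j s z : (j <= n)%N -> wsum (below j) (upd s n z) = wsum (below j) s.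
Proof.
move=> jn; have -> : below j = drop_index n (below j).
  apply/funext => t; rewrite /drop_index; case: ifPn => // nt.
  rewrite /below; case: allP => // /(_ _ nt); by rewrite ltnNge jn.
exact: wsum_drop_upd.
Qed.

Definition exceed x n := [set s | exists2 j, (j <= n)%N & x < `|wsum (below j) s|].

Let measurable_level x c : measurable [set s | x < `|wsum c s|].
Proof.
rewrite [X in measurable X](_ : _ = setT `&` (fun s => `|wsum c s|) @^-1` `]x, +oo[).
  exact: (measurable_norm_weak ip sep (weakly_measurable_wsum c)).
by rewrite setTI; apply/seteqP; split => w /=; rewrite in_itv /= andbT.
Qed.

Lemma exceedS x n : exceed x n.+1 = exceed x n `|` [set s | x < `|wsum (below n.+1) s|].
Proof.
apply/seteqP; split => s /=.
  move=> [j]; rewrite leq_eqVlt => /predU1P[->|jn] h; [by right|left].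
  by exists j.
by move=> [[j jn h]|h]; [exists j => //; exact: leqW|exists n.+1].
Qed.

Lemma measurable_exceed x n : measurable (exceed x n).
Proof.
elim: n => [|n IH].
  rewrite [X in measurable X](_ : _ = [set s | x < `|wsum (below 0) s|]) //.
  apply/seteqP; split => s /=; last by exists 0%N.
  by move=> [j]; rewrite leqn0 => /eqP->.
by rewrite exceedS; apply: measurableU.
Qed.

(** Doob's argument by induction on [n]: the event of an earlier exceedance ignores variable [n], so
    there the integral only grows from [U n] to [U (n + 1)]; a first exceedance at [n + 1] is
    handled directly. *)
Lemma maximal_inequality (a : R) n : 0 < a ->
  (a%:E * nu (exceed (2 * a)%R n) <=
   \int[nu]_(s in exceed (2 * a)%R n) (excess a `|wsum (below n) s|)%:E)%E.
Proof.
move=> a0.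
(* Beyond the level [2 * a] the excess over [a] is at least [a]. *)
have base c D : measurable D -> D `<=` [set s | 2 * a < `|wsum c s|] ->
    (a%:E * nu D <= \int[nu]_(s in D) (excess a `|wsum c s|)%:E)%E.
  move=> mD sD; rewrite -integral_cst //; apply: ge0_le_integral => //.
  - by move=> s _; rewrite lee_fin ltW.
  - by apply: measurable_funTS; exact: measurable_excess_wsum.
  - move=> s /sD /= h; rewrite lee_fin /excess le_max; apply/orP; left; lra.
elim: n => [|n IH].
  apply: base; first exact: measurable_exceed.
  by move=> s /= [j]; rewrite leqn0 => /eqP->.
rewrite exceedS.
set E := exceed _ n; set F := [set s | _ < _].
have -> : E `|` F = E `|` (F `\` E).
  apply/seteqP; split => s [h|h]; [by left| |by left|by right; case: h].
  by have [hE|hE] := pselect (E s); [left|right].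
have mE : measurable E by exact: measurable_exceed.
have mF : measurable (F `\` E) by apply: measurableD => //; exact: measurable_level.
have dEF : [disjoint E & F `\` E] by apply/disj_setPS => s [? []].
rewrite measureU //; last by apply/disj_set2P.
rewrite ge0_integral_setU //; last 2 first.
- by apply: measurable_funTS; exact: measurable_excess_wsum.
- by move=> s _; rewrite lee_fin excess_ge0.
rewrite ge0_muleDr //; apply: leeD; last by apply: base => // s [].
apply: le_trans IH _; rewrite -/E -drop_below.
apply: integral_excess_drop => // s z.
by split => -[j jn h]; exists j => //; move: h; rewrite wsum_below_upd.
Qed.

End DegenerateSums.

(** * Rademacher hypercontractivity in a Hilbert space *)

(** With [A = |u| ^ 2], [B = |v| ^ 2] and [t = inner u v], this bounds the moment of order [2k] of
    [|u + eps v|] for a random sign. The induction must also carry a bound on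
    [2 * t * (X ^ k - Y ^ k)], the cross term that arises when the power is raised. *)
Lemma two_point_moment (R : realFieldType) (A B t : R) (k : nat) :
  0 <= A -> 0 <= B -> t ^+ 2 <= A * B ->
  (A + B + 2 * t) ^+ k + (A + B - 2 * t) ^+ k <= 2 * (A + 5 * k%:R * B) ^+ k.
Proof.
move=> A0 B0 tAB; set X := A + B + 2 * t; set Y := A + B - 2 * t.
suff [] : X ^+ k + Y ^+ k <= 2 * (A + 5 * k%:R * B) ^+ k /\
  2 * t * (X ^+ k - Y ^+ k) <= 8 * k%:R * B * (A + 5 * k%:R * B) ^+ k by [].
elim: k => [|k [IH1 IH2]]; first by split; rewrite !expr0; lra.
set K := k%:R : R in IH1 IH2; have K0 : 0 <= K by rewrite ler0n.
have -> : k.+1%:R = K + 1 :> R by rewrite -natr1.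
set P := (A + 5 * K * B) ^+ k in IH1 IH2.
set P' := (A + 5 * (K + 1) * B) ^+ k.
have KB0 : 0 <= K * B by rewrite mulr_ge0.
have Q0 : 0 <= A + 5 * K * B by lra.
have Q1 : 0 <= A + 5 * (K + 1) * B by lra.
have P0 : 0 <= P by rewrite exprn_ge0.
have PP' : P <= P' by apply: lerXn2r; rewrite ?nnegrE //; lra.
rewrite !exprS -/P'; set x := X ^+ k in IH1 IH2 *; set y := Y ^+ k in IH1 IH2 *.
have BK0 : 0 <= B * K by rewrite mulr_ge0.
(* The pair formed by [x + y] and [2 * t * (x - y)] obeys a linear recursion, closed by
   [t ^ 2 <= A * B]. *)
have -> : X * x + Y * y = (A + B) * (x + y) + 2 * t * (x - y) by rewrite /X /Y; ring.
have -> : 2 * t * (X * x - Y * y) =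
   (A + B) * (2 * t * (x - y)) + 4 * t ^+ 2 * (x + y) by rewrite /X /Y; ring.
have AB0 : 0 <= A + B by rewrite addr_ge0.
have AB0' : 0 <= A * B by rewrite mulr_ge0.
have h1 : (A + B) * (x + y) <= (A + B) * (2 * P) by rewrite ler_wpM2l.
have h2 : (A + B) * (2 * t * (x - y)) <= (A + B) * (8 * K * B * P) by rewrite ler_wpM2l.
have h3 : 4 * t ^+ 2 * (x + y) <= 4 * t ^+ 2 * (2 * P).
  by rewrite ler_wpM2l // mulr_ge0 // sqr_ge0.
have h4 : 4 * t ^+ 2 * (2 * P) <= 4 * (A * B) * (2 * P).
  by apply: ler_wpM2r; [rewrite mulr_ge0|rewrite ler_wpM2l].
split.
  apply: (@le_trans _ _ (2 * ((A + 5 * (K + 1) * B) * P))).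
    have : (A + B) * (2 * P) + 8 * K * B * P <= 2 * ((A + 5 * (K + 1) * B) * P).
      rewrite -subr_ge0 (_ : _ - _ = (2 * (K * B) + 8 * B) * P); last by ring.
      by rewrite mulr_ge0 // addr_ge0 // mulr_ge0.
    lra.
  by rewrite ler_wpM2l // ler_wpM2l // addr_ge0 // !mulr_ge0 // addr_ge0.
apply: (@le_trans _ _ (8 * (K + 1) * B * ((A + 5 * (K + 1) * B) * P))).
  have : (A + B) * (8 * K * B * P) + 4 * (A * B) * (2 * P) <=
         8 * (K + 1) * B * ((A + 5 * (K + 1) * B) * P).
    rewrite -subr_ge0 (_ : _ - _ =
      8 * B * P * (K * B * (4 + 5 * K) + 5 * (K + 1) * B)); last by ring.
    by rewrite mulr_ge0 ?addr_ge0 ?mulr_ge0 ?addr_ge0 ?mulr_ge0 ?addr_ge0.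
  lra.
rewrite ler_wpM2l ?mulr_ge0 ?addr_ge0 //.
by rewrite ler_wpM2l // addr_ge0 // !mulr_ge0 // addr_ge0.
Qed.

Lemma sum_mem_ord_le (n : nat) (s : seq nat) :
  (\sum_(k < n) (val k \in s) <= size s)%N.
Proof.
rewrite (_ : \sum_(k < n) _ = size [seq i <- iota 0 n | i \in s])%N; last first.
  rewrite -(big_mkord xpredT (fun i => (i \in s) : nat)) size_filter.
  rewrite -sum1_count [RHS]big_mkcond /index_iota subn0; apply: eq_bigr => i _.
  by case: (i \in s).
apply: uniq_leq_size; first by rewrite filter_uniq // iota_uniq.
by move=> i; rewrite mem_filter => /andP[].
Qed.

Section Hypercontractivity.
Context {R : realType} {H : normedModType R} {inner : H -> H -> R}.
Hypothesis ip : is_inner_product inner.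
Context {J : eqType} (supp : J -> seq nat) (a : J -> H).

Implicit Types (c : J -> R) (L : seq (R * seq J)) (M : seq J).

Let lin M c : H := \sum_(t <- M) c t *: a t.

(** Weighted blocks interpolate between the squared norm of the whole sum (one block of weight 1)
    and a weighted sum of squared norms of single terms (blocks with at most one term). *)
Let block_form L c : R := \sum_(b <- L) b.1 * `|lin b.2 c| ^+ 2.

Let without n M := [seq t <- M | n \notin supp t].
Let with_ n M := [seq t <- M | n \in supp t].

Let split_blocks sigma n L :=
  [seq (b.1, without n b.2) | b <- L] ++ [seq (sigma * b.1, with_ n b.2) | b <- L].

Let block_form_split sigma n L c : block_form (split_blocks sigma n L) c =
  \sum_(b <- L) b.1 * `|lin (without n b.2) c| ^+ 2 +
  sigma * \sum_(b <- L) b.1 * `|lin (with_ n b.2) c| ^+ 2.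
Proof.
rewrite /block_form big_cat !big_map /= mulr_sumr; congr (_ + _).
by apply: eq_bigr => b _; rewrite mulrA.
Qed.

Let lin_flip n e c M : lin M (flip_index supp n e c) =
  lin (without n M) c + (2 * e) *: lin (with_ n M) c.
Proof.
rewrite /lin !big_filter scaler_sumr (bigID (fun t => n \in supp t)) /= addrC.
congr (_ + _); apply: eq_bigr => t; rewrite /flip_index; last by move->; rewrite scalerA.
by move/negbTE ->.
Qed.

(** Induction on the list; the new cross term is absorbed because [2 * T * t <= A * y + x * B], by
    the arithmetic-geometric mean inequality. *)
Let sum_cauchy_schwarz (I : Type) (L : seq I) (w : I -> R) (u v : I -> H) :
  (forall i, 0 <= w i) ->
  (\sum_(i <- L) w i * inner (u i) (v i)) ^+ 2 <=
  (\sum_(i <- L) w i * `|u i| ^+ 2) * (\sum_(i <- L) w i * `|v i| ^+ 2).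
Proof.
move=> w0; elim: L => [|i L IH]; first by rewrite !big_nil expr0n mulr0.
rewrite !big_cons.
have A0 : 0 <= \sum_(i <- L) w i * `|u i| ^+ 2.
  by apply: sumr_ge0 => j _; rewrite mulr_ge0 // sqr_ge0.
have B0 : 0 <= \sum_(i <- L) w i * `|v i| ^+ 2.
  by apply: sumr_ge0 => j _; rewrite mulr_ge0 // sqr_ge0.
move: A0 B0 IH; set A := \sum_(i <- L) _; set B := \sum_(i <- L) _; set T := \sum_(i <- L) _.
move=> A0 B0 IH.
have := sqr_inner_le ip (u i) (v i).
have := sqr_ge0 `|u i|; have := sqr_ge0 `|v i|; have := w0 i.
move: (inner (u i) (v i)) (`|u i| ^+ 2) (`|v i| ^+ 2) (w i) => t x y wi wi0 y0 x0 txy.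
have cross : 2 * T * t <= A * y + x * B.
  have s0 : 0 <= A * y + x * B by rewrite addr_ge0 // mulr_ge0.
  apply: le_trans (ler_norm _) _.
  rewrite -(@ler_pXn2r _ 2) ?nnegrE // real_normK ?num_real //.
  have -> : (2 * T * t) ^+ 2 = 4 * (T ^+ 2 * t ^+ 2) by ring.
  have : T ^+ 2 * t ^+ 2 <= (A * B) * (x * y) by rewrite ler_pM // sqr_ge0.
  have := sqr_ge0 (A * y - x * B).
  nra.
have : wi * (2 * T * t) <= wi * (A * y + x * B) by rewrite ler_wpM2l.
have : wi ^+ 2 * t ^+ 2 <= wi ^+ 2 * (x * y) by rewrite ler_wpM2l // sqr_ge0.
nra.
Qed.

(** Averaging one sign in the power of a block form gives the power of another block form, with
    every block split by whether [n] occurs. This closure is what allows the signs to be removed one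
    after the other. *)
Let block_form_flip k n L c : (forall b, b \in L -> 0 <= b.1) ->
  block_form L (flip_index supp n 1 c) ^+ k + block_form L (flip_index supp n (-1) c) ^+ k <=
  2 * block_form (split_blocks (20 * k%:R) n L) c ^+ k.
Proof.
move=> L0.
(* Weights are nonnegative on [L] only, while [sum_cauchy_schwarz] asks for it everywhere. *)
pose w (b : R * seq J) := Num.max b.1 0.
have w0 b : 0 <= w b by rewrite /w le_max lexx orbT.
have wE (F : R * seq J -> R) : \sum_(b <- L) b.1 * F b = \sum_(b <- L) w b * F b.
  rewrite big_seq [RHS]big_seq; apply: eq_bigr => b bL; congr (_ * _).
  by rewrite /w max_l // L0.
pose u (b : R * seq J) := lin (without n b.2) c.
pose v (b : R * seq J) := lin (with_ n b.2) c.
have flipE e : e ^+ 2 = 1 -> block_form L (flip_index supp n e c) =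
    \sum_(b <- L) w b * `|u b| ^+ 2 + 4 * (\sum_(b <- L) w b * `|v b| ^+ 2) +
    2 * e * (2 * \sum_(b <- L) w b * inner (u b) (v b)).
  move=> e2; rewrite /block_form wE !mulr_sumr -!big_split /=; apply: eq_bigr => b _.
  rewrite lin_flip (sqr_normD ip) (innerZr ip) normrZ exprMn real_normK ?num_real //.
  rewrite exprMn e2 -/(u b) -/(v b); ring.
rewrite (flipE 1) ?expr1n // (flipE (-1)) ?sqrrN ?expr1n //.
rewrite block_form_split !wE.
have := sum_cauchy_schwarz L u v w0.
have := @sumr_ge0 R _ L xpredT (fun b => w b * `|u b| ^+ 2)
  (fun b _ => mulr_ge0 (w0 b) (sqr_ge0 _)).
have := @sumr_ge0 R _ L xpredT (fun b => w b * `|v b| ^+ 2)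
  (fun b _ => mulr_ge0 (w0 b) (sqr_ge0 _)).
move: (\sum_(b <- L) w b * `|u b| ^+ 2) => A.
move: (\sum_(b <- L) w b * `|v b| ^+ 2) => B.
move: (\sum_(b <- L) w b * inner (u b) (v b)) => t B0 A0 tAB.
have tAB' : (2 * t) ^+ 2 <= A * (4 * B) by rewrite exprMn; lra.
have B0' : 0 <= 4 * B by rewrite mulr_ge0.
(* Used with [4 * B] and [2 * t]: the factor 2 of [flip_index], squared, turns [5 * k] into
   [20 * k]. *)
have := two_point_moment k A0 B0' tAB'.
rewrite !mulr1 mulrN1 mulNr.
by rewrite (_ : 5 * k%:R * (4 * B) = 20 * k%:R * B) //; ring.
Qed.

Fixpoint split_upto sigma n L :=
  if n is n'.+1 then split_upto sigma n' (split_blocks sigma n' L) else L.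

Let split_blocks_ge0 sigma n L : 0 <= sigma -> (forall b, b \in L -> 0 <= b.1) ->
  forall b, b \in split_blocks sigma n L -> 0 <= b.1.
Proof.
move=> s0 L0 b; rewrite mem_cat => /orP[] /mapP[b' bL -> /=]; first exact: L0.
by rewrite mulr_ge0 // L0.
Qed.

Let sum_block_form k n L c : (forall b, b \in L -> 0 <= b.1) ->
  \sum_(c' <- sign_patterns supp n c) block_form L c' ^+ k <=
  2 ^+ n * block_form (split_upto (20 * k%:R) n L) c ^+ k.
Proof.
elim: n L => [|n IH] L L0; first by rewrite big_seq1 expr0 mul1r.
rewrite big_sign_patternsS.
apply: (@le_trans _ _ (\sum_(c' <- sign_patterns supp n c)
    2 * block_form (split_blocks (20 * k%:R) n L) c' ^+ k)).
  by apply: ler_sum => c' _; exact: block_form_flip.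
rewrite -mulr_sumr exprS -mulrA ler_wpM2l // IH //.
by apply: split_blocks_ge0 => //; rewrite mulr_ge0.
Qed.

(** Terms of a block are told apart by their indices below [n], so after all the splittings each
    block holds at most one term, and its weight has gained one factor [sigma] per index of that
    term. *)
Let split_uptoE sigma n L c :
  (forall b, b \in L -> uniq b.2) ->
  (forall b, b \in L -> forall t t', t \in b.2 -> t' \in b.2 ->
     (forall k, (k < n)%N -> (k \in supp t) = (k \in supp t')) -> t = t') ->
  block_form (split_upto sigma n L) c =
  \sum_(b <- L) b.1 * \sum_(t <- b.2)
     sigma ^+ (\sum_(k < n) (val k \in supp t)) * `|c t *: a t| ^+ 2.
Proof.
elim: n L => [|n IH] L uL iL.
  rewrite /= /block_form big_seq [RHS]big_seq; apply: eq_bigr => b bL; congr (_ * _).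
  have := uL b bL; have := iL b bL; rewrite /lin.
  case: b.2 => [|t [|t' M]] i u.
  - by rewrite !big_nil normr0 expr0n.
  - by rewrite !big_seq1 big_ord0 expr0 mul1r.
  - exfalso; move: u => /= /andP[]; rewrite inE negb_or => /andP[/eqP + _] _.
    apply; apply: i => //; first by rewrite mem_head.
    by rewrite inE mem_head orbT.
rewrite /= IH; last 2 first.
- move=> b; rewrite mem_cat => /orP[] /mapP[b' bL -> /=];
    by rewrite filter_uniq // uL.
- move=> b; rewrite mem_cat => /orP[] /mapP[b' bL -> /=] t t';
    rewrite !mem_filter => /andP[nt tb] /andP[nt' tb'] h;
    apply: (iL b' bL) => // k; rewrite ltnS leq_eqVlt => /predU1P[->|/h//].
    by rewrite (negbTE nt) (negbTE nt').
  by rewrite nt nt'.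
rewrite big_cat /= !big_map /= -big_split /=; apply: eq_bigr => b _.
rewrite [in RHS](bigID (fun t => n \in supp t)) /= mulrDr addrC; congr (_ + _).
  rewrite big_filter (mulrC sigma) -mulrA mulr_sumr; congr (_ * _).
  apply: eq_bigr => t nt; rewrite big_ord_recr /= nt addn1 (exprS sigma).
  by rewrite mulrA.
rewrite big_filter; congr (_ * _); apply: eq_bigr => t /negbTE nt.
by rewrite big_ord_recr /= nt addn0.
Qed.

(** Starting from the single block [(1, M)], each term ends with a weight that is a power of
    [20 * k] of exponent at most [m], the size of its support. *)
Lemma hypercontractivity (k m n : nat) M c : (0 < k)%N -> uniq M ->
  (forall t, t \in M -> (size (supp t) <= m)%N) ->
  (forall t t', t \in M -> t' \in M ->
     (forall i, (i < n)%N -> (i \in supp t) = (i \in supp t')) -> t = t') ->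
  \sum_(c' <- sign_patterns supp n c) `|\sum_(t <- M) c' t *: a t| ^+ (2 * k) <=
  2 ^+ n * ((20 * k%:R) ^+ m * \sum_(t <- M) `|c t *: a t| ^+ 2) ^+ k.
Proof.
move=> k0 uM sM iM.
have s1 : 1 <= 20 * k%:R :> R by rewrite -natrM ler1n muln_gt0 k0.
have s0 : 0 <= 20 * k%:R :> R by rewrite (le_trans ler01).
pose L : seq (R * seq J) := [:: (1, M)].
have EL c' : block_form L c' = `|\sum_(t <- M) c' t *: a t| ^+ 2.
  by rewrite /block_form big_seq1 mul1r.
under eq_bigr do rewrite exprM -EL.
have L0 (b : R * seq J) : b \in L -> 0 <= b.1 by rewrite inE => /eqP ->.
apply: le_trans (sum_block_form k n c L0) _.
have E : block_form (split_upto (20 * k%:R) n L) c = \sum_(t <- M)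
     (20 * k%:R) ^+ (\sum_(k < n) (val k \in supp t)) * `|c t *: a t| ^+ 2.
  rewrite split_uptoE ?big_seq1 ?mul1r //.
    by move=> b; rewrite inE => /eqP ->.
  by move=> b; rewrite inE => /eqP ->.
rewrite E ler_wpM2l ?exprn_ge0 // lerXn2r ?nnegrE //.
- by apply: sumr_ge0 => t _; rewrite mulr_ge0 ?exprn_ge0.
- rewrite mulr_ge0 ?exprn_ge0 //; apply: sumr_ge0 => t _; exact: sqr_ge0.
rewrite mulr_sumr big_seq [leRHS]big_seq; apply: ler_sum => t tM.
rewrite ler_wpM2r ?sqr_ge0 // ler_weXn2l //.
exact: leq_trans (sum_mem_ord_le n (supp t)) (sM t tM).
Qed.

End Hypercontractivity.

(** * Choice of the moment order *)

Section TruncatedMoments.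
Context {R : realType}.
Implicit Types (a x y z q r : R) (Z : seq R).

(** For [z > a] one has [z - a <= z ^ 2 / a], and raising [(z / a) ^ 2 > 1] to the power [k] only
    increases it. *)
Lemma excess_le_pow a z k : 0 < a -> 0 <= z -> (0 < k)%N ->
  excess a z <= a * (z ^+ (2 * k) / (a ^+ 2) ^+ k).
Proof.
move=> a0 z0 k0; rewrite exprM -expr_div_n.
have a20 : 0 < a ^+ 2 by rewrite exprn_gt0.
rewrite /excess ge_max; apply/andP; split; last first.
  by rewrite mulr_ge0 ?exprn_ge0 ?divr_ge0 ?sqr_ge0 // ltW.
have [za|az] := leP z a.
  apply: (@le_trans _ _ 0); first by rewrite subr_le0.
  by rewrite mulr_ge0 ?exprn_ge0 ?divr_ge0 ?sqr_ge0 // ltW.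
have w1 : 1 <= z ^+ 2 / a ^+ 2.
  by rewrite ler_pdivlMr // mul1r lerXn2r ?nnegrE ?(ltW a0) ?(ltW az).
apply: (@le_trans _ _ (a * (z ^+ 2 / a ^+ 2))).
  have -> : a * (z ^+ 2 / a ^+ 2) = z ^+ 2 / a by field; rewrite gt_eqF.
  by rewrite ler_pdivlMr //; nra.
apply: ler_wpM2l; first exact: ltW.
by rewrite -[leLHS]expr1 ler_weXn2l.
Qed.

(** Chosen so that [(40 r) ^ m * (chaos_threshold m * y ^ 2)] equals [e^-1 * (x / 2) ^ 2] when
    [r ^ m = (x / y) ^ 2]. *)
Definition chaos_threshold (m : nat) : R := expR (-1) / (4 * 40 ^+ m).

Lemma chaos_threshold_gt0 m : 0 < chaos_threshold m.
Proof. by rewrite divr_gt0 ?expR_gt0 // mulr_gt0 // exprn_gt0. Qed.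

(* If [q <= chaos_threshold m * y ^+ 2], the moment of order [2k] with [r <= k <= 2r]
   makes every factor at most [e^-1]; otherwise the second moment suffices. *)
Lemma sum_excess_le (m : nat) x y q (K : R) Z : (0 < m)%N -> 0 < y -> y <= x ->
  0 < K -> 0 <= q -> (forall z, z \in Z -> 0 <= z) ->
  (forall k, (0 < k)%N ->
     \sum_(z <- Z) z ^+ (2 * k) <= K * ((20 * k%:R) ^+ m * q) ^+ k) ->
  \sum_(z <- Z) excess (x / 2) z <=
  K * (x / 2) * (expR (- ((x / y) `^ (2 / m%:R))) +
     8 * 20 ^+ m * Num.max (q / y ^+ 2 - chaos_threshold m / 2) 0).
Proof.
move=> m0 y0 yx K0 q0 Z0 hk.
have x0 : 0 < x by exact: lt_le_trans yx.
set a := x / 2; have a0 : 0 < a by rewrite divr_gt0.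
set c1 := chaos_threshold m; have c10 : 0 < c1 := chaos_threshold_gt0 m.
have y20 : 0 < y ^+ 2 by rewrite exprn_gt0.
have x20 : 0 < x ^+ 2 by rewrite exprn_gt0.
have a20 : 0 < a ^+ 2 by rewrite exprn_gt0.
have a2E : a ^+ 2 = x ^+ 2 / 4 by rewrite /a; field.
have xy1 : 1 <= x / y by rewrite ler_pdivlMr // mul1r.
set r := (x / y) `^ (2 / m%:R).
have rm : r ^+ m = (x / y) ^+ 2.
  rewrite /r -powR_mulrn ?powR_ge0 // -powRrM -mulrA mulVf ?pnatr_eq0 -?lt0n //.
  by rewrite mulr1 powR_mulrn // divr_ge0 ?ltW.
have r1 : 1 <= r.
  rewrite leNgt; apply/negP => rlt1.
  have : r ^+ m < 1 by rewrite exprn_ilt1 ?powR_ge0 // -lt0n.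
  by rewrite rm ltNge exprn_ege1.
have sumk k : (0 < k)%N ->
    \sum_(z <- Z) excess a z <= K * a * ((20 * k%:R) ^+ m * q / a ^+ 2) ^+ k.
  move=> k0; apply: (@le_trans _ _ (\sum_(z <- Z) a * (z ^+ (2 * k) / (a ^+ 2) ^+ k))).
    rewrite big_seq [leRHS]big_seq; apply: ler_sum => z zZ.
    by apply: excess_le_pow => //; exact: Z0.
  rewrite -mulr_sumr -mulr_suml (mulrC K) -[leRHS]mulrA ler_wpM2l ?(ltW a0) //.
  rewrite (expr_div_n _ (a ^+ 2) k) mulrA ler_wpM2r ?hk //.
  by rewrite invr_ge0 exprn_ge0 // ltW.
have Ka0 : 0 < K * a by rewrite mulr_gt0.
have [qs|qb] := leP q (c1 * y ^+ 2).
  (* An integer between [r] and [2 * r], which exists since [r >= 1]. *)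
  pose n : nat := (Num.truncn r).+1.
  have [rk kr] : r <= n%:R /\ n%:R <= 2 * r.
    have r0 : 0 <= r by rewrite (le_trans ler01).
    have /andP[h1 h2] := truncn_itv r0.
    split; first exact: ltW.
    by rewrite /n -natr1; lra.
  apply: le_trans (sumk n isT) _; rewrite ler_wpM2l ?(ltW Ka0) //.
  apply: (@le_trans _ _ (expR (- r))); last first.
    by rewrite lerDl mulr_ge0 ?mulr_ge0 ?exprn_ge0 // le_max lexx orbT.
  apply: (@le_trans _ _ (expR (- 1) ^+ n)); last first.
    by rewrite -expRM_natl ler_expR mulrN1 lerN2.
  have rm0 : 0 < r ^+ m by rewrite exprn_gt0 // (lt_le_trans ltr01).
  apply: lerXn2r; rewrite ?nnegrE ?expR_ge0 //.
    by rewrite divr_ge0 ?mulr_ge0 ?exprn_ge0 ?mulr_ge0 // ltW.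
  rewrite ler_pdivrMr // a2E.
  have -> : x ^+ 2 = r ^+ m * y ^+ 2 by rewrite rm expr_div_n divfK // gt_eqF.
  apply: (@le_trans _ _ ((40 * r) ^+ m * (c1 * y ^+ 2))).
    apply: ler_pM => //.
    apply: lerXn2r; rewrite ?nnegrE ?mulr_ge0 //; first by rewrite (le_trans ler01).
    by lra.
  rewrite /c1 /chaos_threshold exprMn le_eqVlt; apply/orP; left; apply/eqP.
  by field; rewrite expf_neq0.
(* Above the threshold [k = 1] is enough: [q / y ^ 2 >= c1] gives
   [q / y ^ 2 <= 2 * (q / y ^ 2 - c1 / 2)], which is why half the threshold is subtracted. *)
apply: le_trans (sumk 1%N isT) _; rewrite ler_wpM2l ?(ltW Ka0) //.
rewrite mulr1 expr1 a2E.
apply: (@le_trans _ _ (8 * 20 ^+ m * (q / y ^+ 2 - c1 / 2))); last first.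
  apply: (@le_trans _ _ (8 * 20 ^+ m * Num.max (q / y ^+ 2 - c1 / 2) 0)).
    by rewrite ler_wpM2l ?mulr_ge0 ?exprn_ge0 // le_max lexx.
  by rewrite lerDr expR_ge0.
have -> : 20 ^+ m * q / (x ^+ 2 / 4) = 20 ^+ m * (4 * (q / x ^+ 2)).
  by field; rewrite gt_eqF.
rewrite (mulrC 8) -mulrA ler_wpM2l ?exprn_ge0 //.
have : q / x ^+ 2 <= q / y ^+ 2.
  by rewrite ler_wpM2l // lef_pV2 ?posrE // lerXn2r ?nnegrE ?(ltW x0) ?(ltW y0).
have : c1 <= q / y ^+ 2 by rewrite ler_pdivlMr // ltW.
lra.
Qed.

End TruncatedMoments.

(** * Increasing tuples and their index sets *)

Section IncreasingTuples.
Context {m : nat}.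
Implicit Types t : m.-tuple nat.

(** Tuple entries start at 1, coordinates of the sequence space at 0. *)
Definition indices t : seq nat := [seq k.-1 | k <- t].

Lemma incb_uniq t : incb t -> uniq t.
Proof.
by rewrite /incb => /(sorted_uniq ltn_trans ltnn) /= /andP[].
Qed.

Lemma incb_gt0 t k : incb t -> k \in t -> (0 < k)%N.
Proof.
by rewrite /incb /= => /(order_path_min ltn_trans) /allP; apply.
Qed.

Lemma mem_indices t k : incb t -> (k \in indices t) = (k.+1 \in t).
Proof.
move=> it; apply/mapP/idP => [[i ti ->]|kt]; last by exists k.+1.
by rewrite prednK // (incb_gt0 it).
Qed.

Lemma incb_tnth_inj t i j : incb t -> tnth t i = tnth t j -> i = j.
Proof.
move=> /incb_uniq ut; rewrite !(tnth_nth 0%N) => /eqP.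
by rewrite nth_uniq ?size_tuple // => /eqP /val_inj.
Qed.

End IncreasingTuples.

(** * Decoupling of the scalar quadratic form by random colourings *)

Section Decoupling.
Context {R : realType} {d : measure_display} {S : measurableType d}.
Context {nu : probability (seqsp nat S) R} {mu : probability S R}.
Hypothesis inu : iid_family nu mu (fun i (s : seqsp nat S) => s i).
Context {m : nat}.
Hypothesis m0 : (0 < m)%N.
Context {d' : measure_display} {T' : measurableType d'} {P' : probability T' R}.
Variable X : 'I_m -> nat -> T' -> S.
Hypothesis mX : forall l k, measurable_fun setT (X l k).
Hypothesis iX : iid_family P' mu (fun li : 'I_m * nat => X li.1 li.2).

Implicit Types t : m.-tuple nat.

Definition subsequence t (s : nat -> S) : 'I_m -> S := fun j => s (tnth t j).-1.

Lemma measurable_subsequence t : measurable_fun setT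
  ((fun s => subsequence t s) : seqsp nat S -> seqsp 'I_m S).
Proof. by apply: measurable_to_seqsp => j; exact: measurable_coord. Qed.

Section Weights.
Variable N : nat.
Implicit Type delta : {ffun 'I_N -> 'I_m}.

(* The density, up to the factor [m ^ m], of the event that a uniform colouring
   [delta] gives the colour [j] to the [j]-th entry of [t], for all [j]. *)
Definition colour_weight t delta : R :=
  \prod_(k < N) (if k.+1 \in t then if tnth t (delta k) == k.+1 then m%:R else 0 else 1).

(** The sum of products factors over the indices. Each factor is [m]: an index outside [t] gives
    weight 1 to all [m] colours, an index of [t] gives weight [m] to the colour of its unique
    position. *)
Lemma sum_colour_weight t : incb t -> \sum_delta colour_weight t delta = m%:R ^+ N.
Proof.
move=> it.
rewrite -(bigA_distr_bigA (fun (k : 'I_N) (l : 'I_m) =>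
  if k.+1 \in t then if tnth t l == k.+1 then m%:R else 0 else 1 : R)).
rewrite (_ : m%:R ^+ N = \prod_(k < N) m%:R); last by rewrite prodr_const card_ord.
apply: eq_bigr => k _.
case kt: (k.+1 \in t); last by rewrite sumr_const card_ord.
have [l0 kl0] := tnthP _ _ kt.
rewrite (bigD1 l0) //= -kl0 eqxx big1 ?addr0 // => l ll0; case: eqP => // h.
by move: ll0; rewrite (incb_tnth_inj it (etrans h kl0)) eqxx.
Qed.

Lemma colour_weight_le t delta : incb t -> colour_weight t delta <= m%:R ^+ m.
Proof.
move=> it; have m1 : 1 <= m%:R :> R by rewrite ler1n.
apply: (@le_trans _ _ (\prod_(k < N) m%:R ^+ (val k \in indices t))).
  apply: ler_prod => k _; rewrite mem_indices //; case: ifP => _; last by rewrite ler01 lexx.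
  by case: ifP => _; rewrite expr1 ?lexx !ler0n.
rewrite prodrXr ler_weXn2l //.
by rewrite (leq_trans (sum_mem_ord_le _ _)) // size_map size_tuple.
Qed.

Lemma colour_weight_neq0 t delta (k : 'I_N) j : incb t ->
  colour_weight t delta != 0 -> tnth t j = k.+1 -> delta k = j.
Proof.
move=> it; rewrite prodf_seq_neq0 => /allP /(_ k (mem_index_enum _)) /= + tk.
rewrite -tk mem_tnth.
case: (tnth t (delta k) =P tnth t j) => [h _|_]; last by rewrite eqxx.
exact: incb_tnth_inj it h.
Qed.

End Weights.

Lemma decoupling (N : nat) (M : seq (m.-tuple nat)) (G : m.-tuple nat -> ('I_m -> S) -> R)
    (b c : R) : 0 <= b ->
  (forall t, t \in M -> incb t /\ forall j, (tnth t j <= N)%N) ->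
  (forall t, t \in M -> measurable_fun setT (G t : seqsp 'I_m S -> R)) ->
  (forall t f, 0 <= G t f) ->
  (\int[nu]_s (Num.max (b * \sum_(t <- M) G t (subsequence t s) - c) 0)%:E <=
   \int[P']_w (Num.max (b * (m%:R ^+ m *
      \sum_(t <- M) G t (fun j => X j (tnth t j).-1 w)) - c) 0)%:E)%E.
Proof.
move=> b0 HM mG G0.
set I := (leRHS).
pose f (delta : {ffun 'I_N -> 'I_m}) (s : nat -> S) : R :=
  Num.max (b * (\sum_(t <- M) colour_weight t delta * G t (subsequence t s)) - c) 0.
have f0 delta s : 0 <= f delta s by rewrite /f le_max lexx orbT.
have msum (T0 : measurableType _) (F : m.-tuple nat -> T0 -> R) (w : m.-tuple nat -> R) :
    (forall t, t \in M -> measurable_fun setT (F t)) ->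
    measurable_fun setT (fun s => \sum_(t <- M) w t * F t s).
  move=> mF.
  have -> : (fun s => \sum_(t <- M) w t * F t s) =
      fun s => \sum_(t <- M) if t \in M then w t * F t s else 0.
    by apply/funext => s; rewrite big_seq [RHS]big_seq; apply: eq_bigr => t ->.
  apply: measurable_sum => t; case tM: (t \in M) => //.
  by apply: measurable_funM => //; exact: mF.
have msum1 (T0 : measurableType _) (F : m.-tuple nat -> T0 -> R) :
    (forall t, t \in M -> measurable_fun setT (F t)) ->
    measurable_fun setT (fun s => \sum_(t <- M) F t s).
  by move=> /(msum _ _ _ (fun=> 1)); under eq_fun do under eq_bigr do rewrite mul1r.
have mf delta : measurable_fun setT (fun s : seqsp nat S => (f delta s)%:E).
  apply/measurable_EFinP/measurable_maxr; last exact: measurable_cst.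
  apply: measurable_funB => //; apply: measurable_funM => //.
  apply: msum => t tM.
  exact: measurableT_comp (mG t tM) (measurable_subsequence t).
have fI delta : (\int[nu]_s (f delta s)%:E <= I)%E.
  (* The colour chosen at and beyond [N] does not matter: tuples of [M] only read coordinates below
     [N]. *)
  pose delta' (k : nat) : 'I_m := oapp delta (Ordinal m0) (insub k).
  pose X' (k : nat) := X (delta' k) k.
  have := @iid_family_transfer _ _ _ _ _ (seqsp nat S) T' _ nu P' mu
    (fun i (s : seqsp nat S) => s i) X' (fun s => (f delta s)%:E).
  rewrite /= => -> //.
  - apply: ge0_le_integral => //.
    + by move=> w _; rewrite lee_fin.
    + apply: (measurableT_comp (mf delta)).
      by apply: measurable_to_seqsp => k; exact: mX.
    + apply/measurable_EFinP/measurable_maxr; last exact: measurable_cst.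
      apply: measurable_funB => //; apply: measurable_funM => //.
      apply: measurable_funM => //.
      apply: msum1 => t tM; apply: (measurableT_comp (mG t tM)).
      by apply: measurable_to_seqsp => j; exact: mX.
    + move=> w _; rewrite lee_fin /f ge_max !le_max lexx orbT andbT; apply/orP; left.
      rewrite lerB // ler_wpM2l // mulr_sumr big_seq [leRHS]big_seq.
      apply: ler_sum => t tM; have [it tN] := HM t tM.
      (* Either the term vanishes, or [delta] colours [t] correctly, so that the recoloured sequence
         read along [t] is the decoupled one, with a weight of at most [m ^ m]. *)
      have [->|w0] := eqVneq (colour_weight t delta) 0.
        by rewrite mul0r mulr_ge0 // exprn_ge0.
      rewrite (_ : subsequence t (X'^~ w) = fun j => X j (tnth t j).-1 w).
        by rewrite ler_wpM2r // colour_weight_le.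
      apply/funext => j; rewrite /subsequence /X' /delta'.
      have kE : (tnth t j).-1.+1 = tnth t j.
        by rewrite prednK // (incb_gt0 it) // mem_tnth.
      have kN : ((tnth t j).-1 < N)%N by rewrite kE.
      by rewrite insubT /= (colour_weight_neq0 it w0 (j := j)).
  - by move=> i; exact: measurable_coord.
  - by move=> i; exact: mX.
  (* Distinct [k] give distinct pairs whatever the colouring, so the recoloured sequence is again
     i.i.d. with law [mu]. *)
  - apply: (iid_family_comp (f := fun k => (delta' k, k)) _ iX).
    by move=> k k' [].
  - by move=> s; rewrite lee_fin.
have mN0 : 0 < m%:R ^+ N :> R by rewrite exprn_gt0 // ltr0n.
(* Convexity of the positive part, multiplied by the number [m ^ N] of colourings. *)
have jensen s : m%:R ^+ N * Num.max (b * \sum_(t <- M) G t (subsequence t s) - c) 0 <=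
    \sum_delta f delta s.
  rewrite maxr_pMr ?(ltW mN0) // mulr0 ge_max; apply/andP; split; last exact: sumr_ge0.
  apply: (@le_trans _ _ (\sum_delta (b * (\sum_(t <- M) colour_weight t delta *
      G t (subsequence t s)) - c))); last first.
    by apply: ler_sum => delta _; rewrite /f le_max lexx.
  rewrite sumrB sumr_const card_ffun !card_ord -mulr_sumr exchange_big /=.
  rewrite mulrBr -[c *+ _]mulr_natl natrX lerB // mulrCA ler_wpM2l //.
  rewrite mulr_sumr big_seq [leRHS]big_seq; apply: ler_sum => t tM.
  by rewrite -mulr_suml sum_colour_weight //; case: (HM t tM).
rewrite -(@lee_pmul2l _ (m%:R ^+ N)%:E) ?lte_fin // -ge0_integralZl //; last 2 first.
- apply/measurable_EFinP/measurable_maxr; last exact: measurable_cst.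
  apply: measurable_funB => //; apply: measurable_funM => //.
  apply: msum1 => t tM; exact: measurableT_comp (mG t tM) (measurable_subsequence t).
- by move=> s _; rewrite lee_fin le_max lexx orbT.
apply: (@le_trans _ _ (\int[nu]_s (\sum_delta (f delta s)%:E))%E).
  apply: ge0_le_integral => //.
  - by move=> s _; rewrite -EFinM lee_fin mulr_ge0 ?(ltW mN0) // le_max lexx orbT.
  - apply: measurable_funeM; apply/measurable_EFinP/measurable_maxr; last exact: measurable_cst.
    apply: measurable_funB => //; apply: measurable_funM => //.
    apply: msum1 => t tM; exact: measurableT_comp (mG t tM) (measurable_subsequence t).
  - by apply: emeasurable_sum => delta; exact: mf.
  - by move=> s _; rewrite -EFinM sumEFin lee_fin jensen.
rewrite ge0_integral_sum //; last by move=> delta s _; rewrite lee_fin.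
apply: (@le_trans _ _ (\sum_(delta : {ffun 'I_N -> 'I_m}) 1%:E * I)%E).
  by apply: lee_sum => delta _; rewrite mul1e.
rewrite -ge0_sume_distrl // sumEFin sumr_const card_ffun !card_ord.
by rewrite natrX.
Qed.

End Decoupling.

(** * Layer-cake formula for the positive part *)

Section LayerCake.
Context {R : realType}.

Lemma integral_id_itv1 (w : R) : 1 < w ->
  (\int[lebesgue_measure]_(u in `[1%R, w[) (2 * u)%:E = (w ^+ 2 - 1)%:E)%E.
Proof.
move=> w1; rewrite integral_itv_bndo_bndc; last first.
  apply/measurable_EFinP; apply: measurable_funTS; exact: measurable_funM.
have cX (x : R) : (fun u : R => u ^+ 2) u @[u --> x] --> x ^+ 2.
  exact: exprn_continuous.
rewrite (@continuous_FTC2 _ (fun u => 2 * u) (fun u => u ^+ 2)) ?expr1n //.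
- apply: continuous_subspaceT => x; apply: cvgM; [exact: cvg_cst|exact: cvg_id].
- split.
  + by move=> x _; exact: exprn_derivable.
  + by apply: cvg_at_right_filter; exact: cX.
  + by apply: cvg_at_left_filter; exact: cX.
- move=> x _; rewrite exp_derive1 /=.
  by rewrite expr1.
Qed.

Context {d : measure_display} {T : measurableType d} (P : probability T R).
Variables (Q : T -> R) (k : R).
Hypotheses (mQ : measurable_fun setT Q) (Q0 : forall w, 0 <= Q w) (k0 : 0 < k).

Let B := [set p : T * measurableTypeR R | k * p.2 < Num.sqrt (Q p.1)].

Let A := [set p : T * measurableTypeR R | 1 <= p.2] `&` B.

Let mB : measurable B.
Proof.
have msqrtQ : measurable_fun setT (fun w => Num.sqrt (Q w)).
  apply: (measurableT_comp _ mQ); apply: continuous_measurable_fun.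
  exact: sqrt_continuous.
have mD : measurable_fun setT
    (fun p : T * measurableTypeR R => (Num.sqrt (Q p.1) - k * p.2 : R)).
  apply: measurable_funB; first exact: (measurableT_comp msqrtQ measurable_fst).
  by apply: measurable_funM => //; exact: measurable_snd.
rewrite (_ : B = setT `&` (fun p => Num.sqrt (Q p.1) - k * p.2) @^-1` `]0, +oo[).
  by apply: mD => //; exact: measurable_itv.
by rewrite setTI; apply/seteqP; split => p /=; rewrite in_itv /= andbT subr_gt0.
Qed.

Let mA : measurable A.
Proof.
apply: measurableI => //.
rewrite [X in measurable X](_ : _ = setT `&` snd @^-1` `[1, +oo[).
  by apply: measurable_snd => //; exact: measurable_itv.
by rewrite setTI; apply/seteqP; split => p /=; rewrite in_itv /= andbT.
Qed.

(** The tail is the integral over [T] of the sections of the indicator of [B], hence measurable by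
    Tonelli. *)
Let measurable_tail : measurable_fun setT
  (fun u : measurableTypeR R => P [set w | k * u < Num.sqrt (Q w)]).
Proof.
have mI : measurable_fun setT (fun p => (\1_B p : R)%:E).
  by apply/measurable_EFinP.
have := @measurable_fun_fubini_tonelli_G _ _ _ _ _ P _ mI
  (fun p => ltac:(rewrite lee_fin indicE; exact: ler0n)).
congr measurable_fun; apply/funext => u; rewrite /fubini_G.
transitivity (\int[P]_w (\1_(ysection B u) w)%:E)%E.
  by apply: eq_integral => w _; rewrite !indicE mem_ysection.
rewrite integral_indic //; last exact: measurable_ysection.
rewrite setIT; congr (P _).
by apply/seteqP; split => w; rewrite /ysection /= inE.
Qed.

(** With [x = sqrt (Q w) / k], the left integrand is [c] times the positive part of [x ^ 2 - 1],
    that is, of the integral of [2 * u] from 1 to [x]; Tonelli exchanges the integrals. *)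
Lemma layer_cake_le (c : R) (n : nat) : 0 < c ->
  (\int[P]_w (Num.max (c / k ^+ 2 * Q w - c) 0)%:E <=
   c%:E * (2%:E * \int[lebesgue_measure]_(u in `[1%R, +oo[)
     ((u * (1 + ln u) ^+ n)%:E * P [set w | (k * u < Num.sqrt (Q w))%R])))%E.
Proof.
move=> c0.
pose f (p : T * measurableTypeR R) := (2 * p.2 * \1_A p)%:E.
have f0 p : (0 <= f p)%E.
  rewrite /f indicE lee_fin; have [|_] := boolP (p \in A); last by rewrite mulr0.
  by rewrite inE => -[/= p1 _]; rewrite mulr1 mulr_ge0 // (le_trans ler01).
have mf : measurable_fun setT f.
  apply/measurable_EFinP; apply: measurable_funM => //.
  by apply: measurable_funM => //; exact: measurable_snd.
have mfw w : measurable_fun setT (fun u => f (w, u)).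
  exact: (measurableT_comp mf (measurable_pair1 w)).
have mfF := measurable_fun_fubini_tonelli_F (m2 := lebesgue_measure) f mf f0.
have pointwise w : ((Num.max (c / k ^+ 2 * Q w - c) 0)%:E <=
    c%:E * \int[lebesgue_measure]_u f (w, u))%E.
  set x := Num.sqrt (Q w) / k.
  have Qx : c / k ^+ 2 * Q w = c * x ^+ 2.
    by rewrite /x expr_div_n sqr_sqrtr // mulrAC mulrA.
  rewrite Qx.
  have x0 : 0 <= x by rewrite divr_ge0 ?sqrtr_ge0 // ltW.
  have [x1|x1] := leP x 1.
    rewrite max_r; first by rewrite mule_ge0 ?lee_fin ?(ltW c0) // integral_ge0.
    by rewrite subr_le0 -[leRHS]mulr1 ler_wpM2l ?(ltW c0) // expr_le1.
  rewrite max_l; last by rewrite subr_ge0 -[leLHS]mulr1 ler_wpM2l ?(ltW c0) // exprn_ege1 // ltW.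
  rewrite (_ : c * x ^+ 2 - c = c * (x ^+ 2 - 1)); last by ring.
  rewrite EFinM -integral_id_itv1 // lee_pmul2l // .
  apply: (@le_trans _ _ (\int[lebesgue_measure]_(u in `[1%R, x[) f (w, u))%E).
    rewrite le_eqVlt; apply/orP; left; apply/eqP; apply: eq_integral => u.
    rewrite inE /= in_itv /= => /andP[u1 ux].
    rewrite /f indicE mem_set ?mulr1 //; split => //=.
    by move: ux; rewrite /x ltr_pdivlMr // mulrC.
  by apply: ge0_subset_integral => //; exact: measurable_itv.
pose g u := ((u * (1 + ln u) ^+ n)%:E * P [set w | (k * u < Num.sqrt (Q w))%R])%E.
have mg : measurable_fun setT g.
  apply: emeasurable_funM; last exact: measurable_tail.
  apply/measurable_EFinP; apply: measurable_funM => //.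
  apply: measurable_funX; apply: measurable_funD => //; exact: measurable_ln.
have g0 u : 1 <= u -> (0 <= g u)%E.
  move=> u1; have u0 : 0 <= u by exact: le_trans u1.
  apply: mule_ge0 => //; rewrite lee_fin; apply: mulr_ge0 => //.
  by apply: exprn_ge0; apply: addr_ge0 => //; exact: ln_ge0.
have mD : measurable (`[1, +oo[%classic : set R) by exact: measurable_itv.
apply: (@le_trans _ _ (\int[P]_w (c%:E * \int[lebesgue_measure]_u f (w, u)))%E).
  apply: ge0_le_integral => //.
  - by move=> w _; rewrite lee_fin le_max lexx orbT.
  - apply/measurable_EFinP/measurable_maxr; last exact: measurable_cst.
    by apply: measurable_funB => //; exact: measurable_funM.
  - exact: measurable_funeM.
rewrite ge0_integralZl //; last 2 first.
- by move=> w _; exact: integral_ge0.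
- by rewrite lee_fin ltW.
rewrite lee_pmul2l // fubini_tonelli //.
rewrite -ge0_integralZl //; last 2 first.
- exact: measurable_funTS mg.
- by move=> u; rewrite /= in_itv /= andbT; exact: g0.
rewrite [leRHS]integral_mkcond.
have m2g : measurable_fun setT ((fun u => 2%:E * g u)%E \_ `[1, +oo[).
  apply/(measurable_restrictT (fun u => 2%:E * g u)%E mD).
  by apply: measurable_funTS; exact: measurable_funeM.
apply: ge0_le_integral => //.
- by move=> u _; apply: integral_ge0.
- exact: (measurable_fun_fubini_tonelli_G (m1 := P) f mf f0).
move=> u _; rewrite patchE; case: ifPn => uD; last first.
  rewrite integral0_eq // => w _; rewrite /f indicE memNset ?mulr0 //.
  by move=> [/= u1 _]; move: uD; rewrite notin_setE /= in_itv /= andbT.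
move: uD; rewrite inE /= in_itv /= andbT => u1.
have mAu : measurable [set w | k * u < Num.sqrt (Q w)].
  rewrite (_ : [set w | _] = ysection B u); first exact: measurable_ysection.
  by apply/seteqP; split => w; rewrite /ysection /= inE.
rewrite (_ : (\int[P]_w f (w, u) = \int[P]_w ((2 * u)%:E *
    (\1_[set w | (k * u < Num.sqrt (Q w))%R] w)%:E))%E); last first.
  apply: eq_integral => w _; rewrite /f -EFinM !indicE /=; congr (_ * _)%:E; congr (_%:R).
  congr nat_of_bool; apply/idP/idP; rewrite !inE /=; first by case.
  by move=> h; split.
have mI : measurable_fun setT
    (fun w => (\1_[set w | (k * u < Num.sqrt (Q w))%R] w : R)%:E).
  by apply/measurable_EFinP.
rewrite (ge0_integralZl _ measurableT mI); last 2 first.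
- by move=> w _; rewrite lee_fin indicE ler0n.
- by rewrite lee_fin mulr_ge0 // (le_trans ler01).
rewrite integral_indic // setIT EFinM -muleA lee_pmul2l // /g.
(* The logarithmic factor enters only here, being at least 1 for [u >= 1]. *)
rewrite lee_wpmul2r // lee_fin -[leLHS]mulr1 ler_wpM2l ?(le_trans ler01) //.
by rewrite exprn_ege1 // lerDl ln_ge0.
Qed.

End LayerCake.

(** * Enumeration of the increasing tuples with bounded entries *)

Section IncreasingTupleSums.
Variable m : nat.

Definition increasing_tuples (n : nat) : seq (m.-tuple nat) :=
  [seq map_tuple val t | t <- enum {: m.-tuple 'I_n.+1} & incb (map_tuple val t)].

Lemma Inc_sumE (W : zmodType) n (F : m.-tuple nat -> W) :
  Inc_sum n F = \sum_(t <- increasing_tuples n) F t.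
Proof. by rewrite /increasing_tuples big_map big_filter big_enum_cond. Qed.

Lemma increasing_tuples_uniq n : uniq (increasing_tuples n).
Proof.
rewrite map_inj_uniq ?filter_uniq -?enumT ?enum_uniq // => t t' /(congr1 val) /= h.
by apply: val_inj; exact: inj_map val_inj _ _ h.
Qed.

Lemma mem_increasing_tuples n t :
  (t \in increasing_tuples n) = incb t && all (fun k => (k <= n)%N) t.
Proof.
apply/mapP/andP => [[t']|[it tn]].
  rewrite mem_filter => /andP[it' _] ->; split => //.
  by apply/allP => k /mapP[i _ ->]; exact: (ltn_ord i).
exists (map_tuple inord t) => /=; last first.
  apply: val_inj => /=; rewrite -map_comp map_id_in // => k kt /=.
  by rewrite inordK // ltnS (allP tn).
rewrite mem_filter mem_enum andbT (_ : map_tuple _ _ = t) //.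
apply: val_inj => /=; rewrite -map_comp map_id_in // => k kt /=.
by rewrite inordK // ltnS (allP tn).
Qed.

Lemma indices_lt n t k : t \in increasing_tuples n -> k \in indices t -> (k < n)%N.
Proof.
by rewrite mem_increasing_tuples => /andP[it tn]; rewrite mem_indices // => /(allP tn).
Qed.

(** A strictly sorted tuple is determined by its set of entries; [hypercontractivity] needs this to
    separate terms. *)
Lemma increasing_tuples_eq n t t' : t \in increasing_tuples n -> t' \in increasing_tuples n ->
  (forall k, (k < n)%N -> (k \in indices t) = (k \in indices t')) -> t = t'.
Proof.
move=> tM tM' h.
have [it it'] : incb t /\ incb t'.
  by move: tM tM'; rewrite !mem_increasing_tuples => /andP[? _] /andP[].
have tsub (t1 t2 : m.-tuple nat) : t1 \in increasing_tuples n -> incb t1 -> incb t2 ->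
    (forall k, (k < n)%N -> (k \in indices t1) = (k \in indices t2)) ->
    {subset t1 <= t2}.
  move=> t1M i1 i2 h12 k k1; have k0 := incb_gt0 i1 k1.
  have k1' : k.-1 \in indices t1 by rewrite mem_indices // prednK.
  move: (k1'); rewrite h12 ?(indices_lt t1M) // mem_indices // prednK //.
have sorted_t (t1 : m.-tuple nat) : incb t1 -> sorted ltn t1 by rewrite /incb /= => /path_sorted.
apply: val_inj; apply: (irr_sorted_eq ltn_trans ltnn); [exact: sorted_t..|].
move=> k; apply/idP/idP; first exact: tsub tM it it' h k.
exact: (tsub _ _ tM' it' it (fun i iN => esym (h i iN)) k).
Qed.

End IncreasingTupleSums.

(** * Tail bound by the decoupled quadratic form *)

Section TailBound.
Context {R : realType} {H : normedModType R} {inner : H -> H -> R}.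
Hypothesis ip : is_inner_product inner.
Hypothesis sep : separable_space H.
Context {d : measure_display} {S : measurableType d}.
Context {nu : probability (seqsp nat S) R} {mu : probability S R}.
Hypothesis inu : iid_family nu mu (fun i (s : seqsp nat S) => s i).
Context {m : nat}.
Hypothesis m0 : (0 < m)%N.
Variable h : m.-tuple nat -> ('I_m -> S) -> H.
Hypothesis mh : forall t, incb t ->
  weakly_measurable (inner := inner) (h t : seqsp 'I_m S -> H).
Let V (t : m.-tuple nat) (s : seqsp nat S) : H := h t (subsequence t s).
Hypothesis V_centered : forall t k, incb t -> k \in indices t ->
  {ae nu, forall s, centered (inner := inner) mu (fun z => V t (upd s k z))}.
Context {d' : measure_display} {T' : measurableType d'} {P' : probability T' R}.
Variable X : 'I_m -> nat -> T' -> S.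
Hypothesis mX : forall l k, measurable_fun setT (X l k).
Hypothesis iX : iid_family P' mu (fun li : 'I_m * nat => X li.1 li.2).
Variable N : nat.
Let M := increasing_tuples m N.

Let incM t : t \in M -> incb t.
Proof. by rewrite mem_increasing_tuples => /andP[]. Qed.

Let mV t : t \in M -> weakly_measurable (inner := inner) (V t).
Proof.
move=> /incM it.
exact: (weakly_measurable_comp (measurable_subsequence t) (mh it)).
Qed.

Let V_upd t k s z : t \in M -> k \notin indices t -> V t (upd s k z) = V t s.
Proof.
move=> tM kt; congr (h t); apply/funext => j; rewrite /subsequence /upd.
case: eqP => // jk; move: kt; rewrite -jk.
by rewrite map_f // mem_tnth.
Qed.

Let VM_centered t k : t \in M -> k \in indices t ->
  {ae nu, forall s, centered (inner := inner) mu (fun z => V t (upd s k z))}.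
Proof. by move=> /incM; exact: V_centered. Qed.

Let Q (w : T') : R := \sum_(t <- M) `|h t (fun j => X j (tnth t j).-1 w)| ^+ 2.

(** Chains the maximal inequality, the symmetrisation, the moment bound at fixed [s], and the
    decoupling of [q]. *)
Lemma exceed_tail_bound (x y : R) : 0 < y -> y <= x ->
  (nu (exceed indices V M x N) <=
   (expR (- ((x / y) `^ (2 / m%:R))))%:E + (8 * 20 ^+ m)%:E *
   \int[P']_w (Num.max ((y ^+ 2)^-1 * (m%:R ^+ m * Q w) -
                        chaos_threshold m / 2) 0)%:E)%E.
Proof.
move=> y0 yx; have x0 : 0 < x by exact: lt_le_trans yx.
set a := x / 2; have a0 : 0 < a by rewrite divr_gt0.
have xE : x = 2 * a by rewrite /a; field.
set r := expR _; set K0 := 8 * 20 ^+ m : R; set c2 := chaos_threshold m / 2 : R.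
have K00 : 0 <= K0 by rewrite mulr_ge0 // exprn_ge0.
pose q (s : seqsp nat S) : R := \sum_(t <- M) `|V t s| ^+ 2.
pose D (s : seqsp nat S) : R := Num.max ((y ^+ 2)^-1 * q s - c2) 0.
have D0 s : 0 <= D s by rewrite /D le_max lexx orbT.
have mnV t : t \in M -> measurable_fun setT (fun s => `|V t s| ^+ 2).
  by move=> tM; apply: measurable_funX; exact: (measurable_norm_weak ip sep (mV tM)).
have mq : measurable_fun setT q.
  have -> : q = fun s => \sum_(t <- M) if t \in M then `|V t s| ^+ 2 else 0.
    by apply/funext => s; rewrite /q big_seq [RHS]big_seq; apply: eq_bigr => t ->.
  apply: measurable_sum => t; case tM: (t \in M) => //; exact: mnV.
have mD : measurable_fun setT (fun s => (D s)%:E).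
  apply/measurable_EFinP/measurable_maxr; last exact: measurable_cst.
  by apply: measurable_funB => //; exact: measurable_funM.
have mE c := measurable_excess_wsum ip sep mV a c.
have E0 c s : (0 <= (excess a `|wsum V M c s|)%:E)%E by rewrite lee_fin excess_ge0.
have step1 : (a%:E * nu (exceed indices V M x N) <=
    \int[nu]_s (excess a `|wsum V M (fun=> 1) s|)%:E)%E.
  rewrite xE; apply: le_trans (maximal_inequality ip sep inu mV V_upd VM_centered N a0) _.
  rewrite (_ : (fun s => _) = fun s => (excess a `|wsum V M (fun=> 1) s|)%:E).
    apply: ge0_subset_integral => //.
    exact: (measurable_exceed ip sep indices mV).
  apply/funext => s; congr (excess a `|_|)%:E; apply: eq_big_seq => t tM.
  rewrite /below (_ : all _ _ = true) //; apply/allP => k; exact: indices_lt.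
have step2 := integral_excess_sign_patterns ip sep inu mV V_upd VM_centered N (fun=> 1) a0.
(* At fixed [s] only the signs vary; the constant [2 ^ N] counts the sign patterns. *)
have pw s : \sum_(c <- sign_patterns indices N (fun=> 1)) excess a `|wsum V M c s| <=
    2 ^+ N * a * (r + K0 * D s).
  have -> : D s = Num.max (q s / y ^+ 2 - chaos_threshold m / 2) 0.
    by rewrite /D mulrC.
  have := @sum_excess_le R m x y (q s) (2 ^+ N)
    [seq `|wsum V M c s| | c <- sign_patterns indices N (fun=> 1)] m0 y0 yx.
  rewrite big_map; apply => //.
  - by apply: sumr_ge0 => t _; exact: sqr_ge0.
  - by move=> z /mapP[c _ ->].
  move=> k k0; rewrite big_map.
  have := @hypercontractivity R H inner ip _ indices (V^~ s) k m N M (fun=> 1) k0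
    (increasing_tuples_uniq m N).
  under [in X in _ <= X]eq_bigr do rewrite scale1r.
  apply; first by move=> t _; rewrite size_map size_tuple.
  exact: increasing_tuples_eq.
have ID : (\int[nu]_s (2 ^+ N * a * (r + K0 * D s))%:E =
    (2 ^+ N * a)%:E * (r%:E + K0%:E * \int[nu]_s (D s)%:E))%E.
  under eq_integral do rewrite EFinM EFinD (EFinM K0).
  have mKD : measurable_fun setT (fun s => K0%:E * (D s)%:E)%E.
    exact: measurable_funeM.
  have KD0 s : (0 <= K0%:E * (D s)%:E)%E by rewrite -EFinM lee_fin mulr_ge0.
  rewrite ge0_integralZl //; last 3 first.
  - exact: emeasurable_funD.
  - by move=> s _; rewrite adde_ge0 // lee_fin expR_ge0.
  - by rewrite lee_fin mulr_ge0 ?exprn_ge0 // ltW.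
  rewrite ge0_integralD //; last by move=> s _; rewrite lee_fin expR_ge0.
  have -> : (\int[nu]_s r%:E = r%:E)%E.
    rewrite integral_cst // [X in (_ * X)%E](_ : _ = 1%E) ?mule1 //.
    exact: probability_setT.
  rewrite ge0_integralZl //.
  by move=> s _; rewrite lee_fin.
have Na0 : 0 < 2 ^+ N * a by rewrite mulr_gt0 // exprn_gt0.
have main : (nu (exceed indices V M x N) <= r%:E + K0%:E * \int[nu]_s (D s)%:E)%E.
  (* Both normalisations, the number of patterns and the level [a], are cancelled together at the
     end. *)
  rewrite -(@lee_pmul2l _ (2 ^+ N * a)%:E) ?lte_fin // -ID.
  rewrite EFinM -muleA; apply: le_trans (lee_wpmul2l _ step1) _.
    by rewrite lee_fin exprn_ge0.
  apply: le_trans step2 _; rewrite -ge0_integral_sum //.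
  apply: ge0_le_integral => //.
  - by move=> s _; apply: sume_ge0 => c _.
  - exact: emeasurable_sum.
  - apply/measurable_EFinP; apply: measurable_funM => //; apply: measurable_funD => //.
    by apply: measurable_funM => //; exact/measurable_EFinP.
  - by move=> s _; rewrite sumEFin lee_fin.
apply: le_trans main _; rewrite leeD2l // lee_wpmul2l ?lee_fin //.
have y20 : 0 <= (y ^+ 2)^-1 by rewrite invr_ge0 exprn_ge0 // ltW.
apply: (decoupling inu m0 mX iX (G := fun t f => `|h t f| ^+ 2) (N := N)) => //.
- move=> t; rewrite mem_increasing_tuples => /andP[it tN]; split => // j.
  by rewrite (allP tN) // mem_tnth.
- move=> t /incM it; apply: measurable_funX.
  exact: (measurable_norm_weak ip sep (mh it)).
Qed.

End TailBound.

(** * Transfer of the degeneracy hypothesis to the sequence space *)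

(** Membership in an invariant [G] is unchanged when coordinate [j0] is overwritten by the constant
    [point], and the overwritten family [Z] depends on the other coordinates only. *)
Lemma sigma_gen_upd_invariant (d : measure_display) (T : measurableType d)
    (dS : measure_display) (S : measurableType dS) (I : choiceType)
    (Y : I -> T -> S) (j0 : I) (G : set (seqsp I S)) :
  measurable G -> upd_invariant j0 G ->
  sigma_gen Y [set j | j != j0] ((fun w => Y^~ w) @^-1` G).
Proof.
move=> mG iG.
pose Z w : I -> S := upd (Y^~ w) j0 point.
have -> : (fun w => Y^~ w) @^-1` G = setT `&` Z @^-1` G.
  by rewrite setTI; apply/seteqP; split => w /=; move/(iG (Y^~ w) point).
have sA : sigma_algebra setT (sigma_gen Y [set j | j != j0]).
  exact: smallest_sigma_algebra.
suff sub : <<s cylinder I S >> `<=`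
    image_set_system setT Z (sigma_gen Y [set j | j != j0]) by exact: sub.
apply: smallest_sub; first exact: sigma_algebra_image.
move=> _ [j [A [mA ->]]]; rewrite /image_set_system /= setTI.
have [jj0|jj0] := eqVneq j j0; last first.
  apply: sub_sigma_algebra; exists j, A; split => //; split => //.
  by apply/seteqP; split => w /=; rewrite /Z /upd (negbTE jj0).
(* Coordinate [j0] of [Z] is constant, so its preimages are [setT] or [set0], both in any
   sigma-algebra. *)
have [pA|pA] := pselect (A point).
  rewrite (_ : _ @^-1` _ = setT `\` set0); first by case: sA => s0 sC _; exact: sC.
  rewrite setD0; apply/seteqP; split => w //= _.
  by rewrite /Z /upd jj0 eqxx.
rewrite (_ : _ @^-1` _ = set0); first by case: sA.
by apply/seteqP; split => w //=; rewrite /Z /upd jj0 eqxx.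
Qed.

Section CenteredTransfer.
Context {R : realType} {H : normedModType R} {inner : H -> H -> R}.
Hypothesis ip : is_inner_product inner.
Hypothesis sep : separable_space H.
Context {d : measure_display} {S : measurableType d} {mu : probability S R}.
Context {dT : measure_display} {T : measurableType dT} {P : probability T R}.
Context {I J : choiceType} (Y : I -> T -> S).
Hypothesis mY : forall i, measurable_fun setT (Y i).
Hypothesis iY : iid_family P mu Y.
Context {nu : probability (seqsp J S) R}.
Hypothesis inu : iid_family nu mu (fun j (s : seqsp J S) => s j).

(** The null set is found under the law of [Y], then pulled back along [s |-> s \o e], whose law
    under [nu] is the same by uniqueness. A hypothesis on [xi_1, ..., xi_m] thus serves for the
    variables selected by any increasing tuple. *)
Lemma ae_centered_transfer (f : seqsp I S -> H) (e : I -> J) (i0 : I) :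
  injective e -> weakly_measurable (inner := inner) f ->
  (\int[P]_w (`|f (Y^~ w)|)%:E < +oo)%E ->
  (forall v G, sigma_gen Y [set i | i != i0] G ->
     (\int[P]_(w in G) (inner (f (Y^~ w)) v)%:E = 0)%E) ->
  {ae nu, forall s, centered (inner := inner) mu
     (fun z => f (fun i => upd s (e i0) z (e i)))}.
Proof.
move=> inje mf fi f0.
have mYs : measurable_fun setT ((fun w => Y^~ w) : T -> seqsp I S).
  exact: measurable_to_seqsp.
have mfY : weakly_measurable (inner := inner) (fun w => f (Y^~ w)).
  exact: (weakly_measurable_comp mYs mf).
have [lam [lamE ilam]] := iid_family_law mY iY.
have eqlam : forall A, measurable A -> A `<=` setT ->
    lam A = pushforward P ((fun w => Y^~ w) : T -> seqsp I S) A.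
  by move=> A _ _; exact: lamE.
have ilf : (\int[lam]_s (`|f s|)%:E < +oo)%E.
  rewrite (eq_measure_integral _ eqlam) ge0_integral_pushforward //.
  by apply/measurable_EFinP; exact: (measurable_norm_weak ip sep mf).
have hG v G : measurable G -> upd_invariant i0 G ->
    (\int[lam]_(s in G) (inner (f s) v)%:E = 0)%E.
  move=> mG iG.
  have mG' : measurable (((fun w => Y^~ w) : T -> seqsp I S) @^-1` G).
    by rewrite -[X in measurable X]setTI; exact: mYs.
  rewrite (@eq_measure_integral _ _ _ G
    (pushforward P ((fun w => Y^~ w) : T -> seqsp I S)) lam); last first.
    by move=> A _ _; exact: lamE.
  rewrite integral_pushforward //.
  - have sg := @sigma_gen_upd_invariant _ T _ S _ Y i0 G mG iG.
    exact: (f0 v _ sg).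
  - apply/measurable_EFinP; exact: (mf v).
  - exact: (integrableS measurableT mG' (@subsetT _ _) (integrable_inner ip sep v mfY fi)).
have [A [mA A0 sA]] := ae_centered_kernel ip sep ilam mf ilf hG.
have mcoord (j : J) : measurable_fun setT (fun s : seqsp J S => s j).
  exact: measurable_coord.
have [lam' [lam'E ilam']] := iid_family_law (fun i => mcoord (e i)) (iid_family_comp inje inu).
have me : measurable_fun setT ((fun s i => s (e i)) : seqsp J S -> seqsp I S).
  by apply: measurable_to_seqsp => i; exact: mcoord.
exists ((fun s i => s (e i)) @^-1` A); split.
- by rewrite -[X in measurable X]setTI; exact: me.
- by rewrite -[LHS](lam'E A) (iid_family_law_unique ilam' ilam mA).
move=> s /= hs; apply: sA => /= hs'; apply: hs; move: hs'.
congr (centered mu); apply/funext => z; congr (f _); apply/funext => i.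
by rewrite /upd (inj_eq inje).
Qed.

End CenteredTransfer.

(** * Partial sums as weighted sums, and the final choice of constants *)

Lemma Inc_sum_below (R : realType) (H : normedModType R) (m n N : nat)
    (F : m.-tuple nat -> H) : (n <= N)%N ->
  Inc_sum n F = \sum_(t <- increasing_tuples m N) (below indices n t : R) *: F t.
Proof.
move=> nN; rewrite Inc_sumE.
rewrite [RHS](bigID (fun t => all (fun k => (k < n)%N) (indices t))) /=.
rewrite [X in _ = _ + X]big1 ?addr0; last first.
  by move=> t /negbTE ht; rewrite /below ht scale0r.
rewrite -[RHS]big_filter (perm_big [seq t <- increasing_tuples m N |
    all (fun k => (k < n)%N) (indices t)]) /=; last first.
  apply: uniq_perm; rewrite ?filter_uniq ?increasing_tuples_uniq // => t.
  rewrite [in RHS]mem_filter !mem_increasing_tuples andbCA.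
  case it: (incb t) => //=.
  rewrite /indices all_map; apply/idP/andP => [tn|[tn _]].
    split; apply/allP => k kt; have /= kn := allP tn k kt.
      by rewrite /= prednK ?(incb_gt0 it).
    exact: leq_trans kn nN.
  apply/allP => k kt; have := allP tn k kt.
  by rewrite /= prednK ?(incb_gt0 it).
rewrite !big_filter; apply: eq_bigr => t ht.
by rewrite /below ht scale1r.
Qed.

Lemma measurable_bigmax (R : realType) (d : measure_display) (T : measurableType d)
    (r : seq nat) (F : nat -> T -> R) : (forall n, measurable_fun setT (F n)) ->
  measurable_fun setT (fun w => \big[Num.max/0]_(n <- r) F n w).
Proof.
move=> mF; elim: r => [|n r IH].
  by under eq_fun do rewrite big_nil; exact: measurable_cst.
by under eq_fun do rewrite big_cons; exact: measurable_maxr.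
Qed.

Theorem theorem1p1 (R : realType) (m : nat) (hm : (1 <= m)%N) :
  exists A B C : R, [/\ 0 < A, 0 < B, 0 < C &
  forall (H : completeNormedModType R) (inner : H -> H -> R),
  is_inner_product inner -> separable_space H ->
  forall (d : measure_display) (T : measurableType d) (P : probability T R)
    (dS : measure_display) (S : measurableType dS)
    (xi : nat -> T -> S) (h : m.-tuple nat -> ('I_m -> S) -> H),
  iid_seq P xi ->
  (* each h_i : S^m -> H is (product, Borel)-measurable *)
  (forall i, incb i -> forall U, borel_sets U -> @prod_sigma _ S m (h i @^-1` U)) ->
  (* E[h_i(xi_1,...,xi_m) | xi_j, j <> j0] = 0 a.s. *)
  (forall i, incb i -> forall j0 : 'I_m,
     let X := fun w => h i (fun j : 'I_m => xi j.+1 w) in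
     (\int[P]_w (`|X w|)%:E < +oo)%E /\
     forall (v : H) (G : set T),
       sigma_gen (fun j : 'I_m => xi j.+1) [set j | j != j0] G ->
       (\int[P]_(w in G) (inner (X w) v)%:E = 0)%E) ->
  (* mutually independent copies xi^(l), l = 1..m, of (xi_i) *)
  forall (d' : measure_display) (T' : measurableType d') (P' : probability T' R)
    (xidec : 'I_m -> nat -> T' -> S),
  (forall l i, (0 < i)%N -> measurable_fun setT (xidec l i)) ->
  mutually_indep P' (fun li : 'I_m * nat => xidec li.1 li.2)
                 (fun li => (0 < li.2)%N) ->
  (forall l i A, (0 < i)%N -> measurable A ->
     P' (xidec l i @^-1` A) = P (xi 1%N @^-1` A)) ->
  forall (x y : R) (N : nat), 0 < x -> 0 < y -> (m <= N)%N ->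
  (P [set w | (x < \big[Num.max/0]_(m <= n < N.+1)
                    `| Inc_sum n (fun i => h i (fun j => xi (tnth i j) w)) |)%R ]
   <= (A * expR (- ((x / y) `^ (2 / m%:R))))%:E
      + B%:E * \int[lebesgue_measure]_(u in `[1%R, +oo[%classic)
          ((u * (1 + ln u) ^+ ((m * m.+1)./2 - 1))%:E *
           P' [set w' | (C * y * u < Num.sqrt (Inc_sum N
                (fun i => `| h i (fun j => xidec j (tnth i j) w') | ^+ 2)))%R]))%E].
Proof.
pose c2 : R := chaos_threshold m / 2.
have c20 : 0 < c2 by rewrite divr_gt0 // chaos_threshold_gt0.
have mm0 : 0 < m%:R ^+ m :> R by rewrite exprn_gt0 // ltr0n.
(* Makes [c2 / (C * y) ^ 2] equal to [m ^ m / y ^ 2], the coefficient of the decoupled sum in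
   [exceed_tail_bound]. *)
pose C : R := Num.sqrt (c2 / m%:R ^+ m).
have C0 : 0 < C by rewrite sqrtr_gt0 divr_gt0.
pose K0 : R := 8 * 20 ^+ m.
have K00 : 0 < K0 by rewrite mulr_gt0 // exprn_gt0.
(* [A = e] makes the bound trivial when [x < y]; in [B], [K0] comes from the tail bound and [c2 * 2]
   from the layer-cake formula. *)
exists (expR 1), (K0 * (c2 * 2)), C; split; [exact: expR_gt0|by rewrite !mulr_gt0|by []|].
move=> H inner ip sep d T P dS S xi h [mxi ixi idxi] mh hh d' T' P' xidec mxd ixd idxd x y N x0 y0 mN.
set r := (x / y) `^ (2 / m%:R).
pose U n w := Inc_sum n (fun i => h i (fun j => xi (tnth i j) w)).
set Emax := [set w | _].
set rhs2 := (\int[lebesgue_measure]_(u in _) _)%E.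
have rhs20 : (0 <= rhs2)%E.
  apply: integral_ge0 => u; rewrite /= in_itv /= andbT => u1.
  apply: mule_ge0 => //; rewrite lee_fin; apply: mulr_ge0; first exact: le_trans u1.
  by apply: exprn_ge0; apply: addr_ge0 => //; exact: ln_ge0.
have B0 : (0 <= (K0 * (c2 * 2))%:E * rhs2)%E.
  by apply: mule_ge0 => //; rewrite lee_fin !mulr_ge0 // ltW.
(* Renumbered from 0, since [iid_seq] speaks of positive indices only. *)
pose X (k : nat) := xi k.+1.
have mX k : measurable_fun setT (X k) by exact: mxi.
pose M1 := isMeasurableFun.Build _ _ _ _ _ (mX 0%N).
pose X0 : {mfun T >-> S} := HB.pack (X 0%N) M1.
pose mu : probability S R := distribution P X0.
have muE A : mu A = P (xi 1%N @^-1` A) by [].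
have iX : iid_family P mu X.
  move=> F A uF mA.
  have := ixi [seq k.+1 | k <- F] (fun i => A i.-1).
  rewrite !big_map /= => ->.
  - by apply: eq_bigr => k _; rewrite muE idxi.
  - by rewrite map_inj_uniq // => ? ? [].
  - by apply/allP => _ /mapP[k _ ->].
  - by move=> i _; exact: mA.
pose Xd (l : 'I_m) (k : nat) := xidec l k.+1.
have mXd l k : measurable_fun setT (Xd l k) by exact: mxd.
have iXd : iid_family P' mu (fun li : 'I_m * nat => Xd li.1 li.2).
  move=> F A uF mA.
  have := ixd [seq (li.1, li.2.+1) | li <- F] (fun li => A (li.1, li.2.-1)).
  rewrite !big_map /= => ixd'.
  rewrite (_ : \big[setI/setT]_(li <- F) _ = \big[setI/setT]_(li <- F)
    (xidec li.1 li.2.+1 @^-1` A (li.1, li.2))); last by apply: eq_bigr => -[].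
  rewrite ixd'.
  - rewrite [LHS]big_seq [RHS]big_seq; apply: eq_bigr => -[l k] _ /=.
    by rewrite idxd.
  - by rewrite map_inj_uniq // => -[l k] [l' k'] [-> ->].
  - by apply/allP => _ /mapP[k _ ->].
  - by move=> i _; exact: mA.
have [nu [nuE inu]] := iid_family_law mX iX.
have mYs : measurable_fun setT ((fun w => X^~ w) : T -> seqsp nat S).
  exact: measurable_to_seqsp.
have mhw t : incb t -> weakly_measurable (inner := inner) (h t : seqsp 'I_m S -> H).
  by move=> it; apply: (weakly_measurable_borel ip) => V bV; exact: mh.
pose V (t : m.-tuple nat) (s : seqsp nat S) : H := h t (subsequence t s).
have Vc t k : incb t -> k \in indices t ->
    {ae nu, forall s, centered (inner := inner) mu (fun z => V t (upd s k z))}.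
  move=> it; rewrite mem_indices // => kt; have [j0 tj0] := tnthP _ _ kt.
  have [hfin hzero] := hh t it j0.
  have inje : injective (fun j : 'I_m => (tnth t j).-1).
    move=> j j' jj'; apply: (incb_tnth_inj it).
    rewrite -(prednK (incb_gt0 it (mem_tnth j t))) jj'.
    by rewrite (prednK (incb_gt0 it (mem_tnth j' t))).
  have := @ae_centered_transfer _ _ _ ip sep _ _ mu _ _ P _ _
    (fun j : 'I_m => X j) (fun j => mX j) (iid_family_comp val_inj iX) nu inu
    (h t) _ j0 inje (mhw _ it) hfin hzero.
  by rewrite -tj0.
have UE n w : U n w = Inc_sum n (fun i => V i (X^~ w)).
  rewrite /U !Inc_sumE big_seq [RHS]big_seq; apply: eq_bigr => t.
  rewrite mem_increasing_tuples => /andP[it _]; congr (h t); apply/funext => j.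
  by rewrite /subsequence /X prednK // (incb_gt0 it) // mem_tnth.
have mU n : measurable_fun setT (fun w => `|U n w|).
  apply: (measurable_norm_weak ip sep).
  have -> : U n = fun w => \sum_(t <- increasing_tuples m n)
      if t \in increasing_tuples m n then V t (X^~ w) else 0.
    apply/funext => w; rewrite UE Inc_sumE big_seq [RHS]big_seq.
    by apply: eq_bigr => t ->.
  apply: (weakly_measurable_sum ip) => t; case tM: (t \in _); last exact: weakly_measurable0.
  move: tM; rewrite mem_increasing_tuples => /andP[it _].
  exact: (weakly_measurable_comp mYs (weakly_measurable_comp (measurable_subsequence t) (mhw _ it))).
have mEmax : measurable Emax.
  rewrite (_ : Emax = setT `&`
      (fun w => \big[Num.max/0]_(m <= n < N.+1) `|U n w|) @^-1` `]x, +oo[).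
    by apply: measurable_bigmax => //; exact: measurable_itv.
  by rewrite setTI; apply/seteqP; split => w; rewrite /Emax /= in_itv /= andbT.
(* For [x < y] the exponent [r] is at most 1, so [e * exp (- r) >= 1] already bounds the
   probability. *)
have [xy|yx] := ltP x y.
  have r1 : r <= 1.
    have q0 : 0 <= x / y by rewrite divr_ge0 // ltW.
    have q1 : x / y <= 1 by rewrite ler_pdivrMr // mul1r ltW.
    have : r <= 1 `^ (2 / m%:R) by rewrite ge0_ler_powR ?nnegrE // divr_ge0.
    by rewrite powR1.
  apply: (@le_trans _ _ 1%E); first exact: probability_le1.
  rewrite -[leLHS]adde0; apply: leeD => //.
  by rewrite lee_fin -expRD -[leLHS]expR0 ler_expR subr_ge0.
pose M := increasing_tuples m N.
have sub : Emax `<=` (fun w => X^~ w) @^-1` (exceed indices V M x N).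
  move=> w; rewrite /Emax /=; apply: contraPP => nex.
  (* The maximum starts from 0, which is below [x]; each [U n] is a [wsum] over the common list
     [M]. *)
  apply/negP; rewrite -leNgt big_nat; apply: (big_ind (fun v => v <= x)).
  - exact: ltW.
  - by move=> u v ux vx; rewrite ge_max ux vx.
  move=> n /andP[_ nN]; rewrite ltnS in nN.
  rewrite leNgt; apply/negP => xn; apply: nex; exists n => //.
  by rewrite /wsum -(Inc_sum_below _ nN) -UE.
have mV t : t \in M -> weakly_measurable (inner := inner) (V t).
  rewrite mem_increasing_tuples => /andP[it _].
  exact: (weakly_measurable_comp (measurable_subsequence t) (mhw _ it)).
have Pnu : (P Emax <= nu (exceed indices V M x N))%E.
  rewrite nuE; apply: le_measure => //; rewrite inE //.
  rewrite -[X in measurable X]setTI; apply: mYs => //.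
  exact: (measurable_exceed ip sep indices mV).
apply: le_trans Pnu _.
apply: le_trans (exceed_tail_bound ip sep inu hm mhw Vc mXd iXd N y0 yx) _.
apply: leeD.
  rewrite lee_fin -[leLHS]mul1r ler_wpM2r ?expR_ge0 //.
  by rewrite -[leLHS]expR0 ler_expR.
rewrite -/K0 (EFinM K0) -muleA lee_pmul2l //.
pose Q (w : T') : R := \sum_(t <- M) `|h t (fun j => Xd j (tnth t j).-1 w)| ^+ 2.
have Q0 w : 0 <= Q w by apply: sumr_ge0 => t _; exact: sqr_ge0.
have mQ : measurable_fun setT Q.
  have -> : Q = fun w => \sum_(t <- M) if t \in M then
      `|h t (fun j => Xd j (tnth t j).-1 w)| ^+ 2 else 0.
    by apply/funext => w; rewrite /Q big_seq [RHS]big_seq; apply: eq_bigr => t ->.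
  apply: measurable_sum => t; case tM: (t \in M) => //.
  move: tM; rewrite mem_increasing_tuples => /andP[it _].
  apply: measurable_funX; apply: (measurable_norm_weak ip sep).
  have mt : measurable_fun setT
      ((fun w j => Xd j (tnth t j).-1 w) : T' -> seqsp 'I_m S).
    by apply: measurable_to_seqsp => j; exact: mXd.
  exact: (weakly_measurable_comp mt (mhw _ it)).
have Cy0 : 0 < C * y by rewrite mulr_gt0.
have := layer_cake_le P' mQ Q0 Cy0 ((m * m.+1)./2 - 1) c20.
rewrite (EFinM c2) -muleA.
have -> : rhs2 = (\int[lebesgue_measure]_(u in `[1%R, +oo[)
     ((u * (1 + ln u) ^+ ((m * m.+1)./2 - 1))%:E *
      P' [set w | (C * y * u < Num.sqrt (Q w))%R]))%E.
  apply: eq_integral => u _; congr (_ * P' _)%E; apply/seteqP.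
  have QE w : Inc_sum N (fun i => `|h i (fun j => xidec j (tnth i j) w)| ^+ 2) = Q w.
    rewrite Inc_sumE /Q big_seq [RHS]big_seq; apply: eq_bigr => t.
    rewrite mem_increasing_tuples => /andP[it _]; congr (`|h t _| ^+ 2).
    apply/funext => j; by rewrite /Xd prednK // (incb_gt0 it) // mem_tnth.
  by split => w /=; rewrite QE.
apply: le_trans; rewrite le_eqVlt; apply/orP; left; apply/eqP.
apply: eq_integral => w _; congr ((Num.max (_ - _) 0)%:E).
rewrite exprMn sqr_sqrtr; last by rewrite divr_ge0 ?ltW.
by rewrite /Q -/c2; field; rewrite !gt_eqF // exprn_gt0.
Qed.
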